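(* Let $m,\tilde m\in\mathbb{N}$ with $m\le\tilde m$ and $m+\tilde m\in2\mathbb{N}$, and let $p\in\mathbb{N}_0$. Let $\tilde\Psi=(\tilde\psi_0,\dots,\tilde\psi_p)^T$ be the generalized dual quarklets, defined by $$\tilde\Psi=\sum_{k\in\mathbb{Z}}\tilde B_k\tilde\Phi(2\cdot-k),$$ where $\tilde\Phi$ are the generalized dual quarks and $\{\tilde B_k\}_{k\in\mathbb{Z}}$ is the matrix sequence with $\frac12\sum_k\tilde B_kz^k=\tilde{\mathcal{B}}(z)$, $\overline{\tilde{\mathcal{B}}(z)}^T=-T(z)^{-1}\mathcal{A}(-z)$ for $|z|=1$. Then all $\tilde\psi_q$ with $q\in\{0,1,\dots,p\}$ are compactly supported distributions from $\mathcal{S}'(\mathbb{R})$.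
   Context: $\mathbb{N}=\{1,2,\dots\}$, $\mathbb{N}_0=\mathbb{N}\cup\{0\}$. Fourier transform: $(\mathcal{F}f)(\xi)=\frac1{\sqrt{2\pi}}\int_{\mathbb{R}}f(x)e^{-ix\xi}dx$, extended to $\mathcal{S}'(\mathbb{R})$. Coefficients $b_k$: put $K=(m+\tilde m)/2$ and for $|z|=1$ let $\tilde a(z)=z^{-\lfloor\tilde m/2\rfloor}\big(\tfrac{1+z}{2}\big)^{\tilde m}\sum_{n=0}^{K-1}\binom{K-1+n}{n}\big(\tfrac{2-z-z^{-1}}{4}\big)^n$ (symbol of the Cohen--Daubechies--Feauveau dual generator). The finitely supported real sequence $(b_k)_{k\in\mathbb{Z}}$ is determined by $b(z):=\frac12\sum_kb_kz^k=-z\,\overline{\tilde a(-z)}$ for $|z|=1$. Refinement matrices: $A_k$ is the $(p+1)\times(p+1)$ matrix with $(A_k)_{q,l}=2^{1-q}\lceil m/2\rceil^{l-q}a_k\binom{q-1}{l-1}k^{q-l}$, $q,l\in\{1,\dots,p+1\}$, where $a_k=2^{1-m}\binom{m}{k+\lfloor m/2\rfloor}$ for $-\lfloor m/2\rfloor\le k\le\lceil m/2\rceil$, $a_k=0$ otherwise (entries with $l>q$ are $0$, $0^0=1$). Put $\mathcal{A}(z)=\frac12\sum_kA_kz^k$ and $T(z)=\mathcal{A}(z)b(-z)-b(z)\mathcal{A}(-z)$, which is invertible for $|z|=1$. Let $\tilde{\mathcal{A}}(z)$ be given by $\overline{\tilde{\mathcal{A}}(z)}^T=b(-z)T(z)^{-1}$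 for $|z|=1$, and write $\tilde{\mathcal{A}}(z)=\frac12\sum_k\tilde A_kz^k$; both $\{\tilde A_k\}$ and $\{\tilde B_k\}$ are finitely supported. Generalized dual quarks: $\tilde\Phi=(\tilde\varphi_0,\dots,\tilde\varphi_p)^T\in(\mathcal{S}'(\mathbb{R}))^{p+1}$ is the compactly supported distributional solution vector of $\tilde\Phi=\sum_k\tilde A_k\tilde\Phi(2\cdot-k)$ given by $\tilde\Phi=D^p\mathcal{F}^{-1}\big[\prod_{j=1}^\infty2^{-p}\tilde{\mathcal{A}}(e^{-i2^{-j}\xi})v\big]$, where $v$ is a right eigenvector of $2^{-p}\tilde{\mathcal{A}}(1)$ for the eigenvalue $1$, $D^p$ is the $p$-th distributional derivative, and the matrix product is ordered with increasing $j$ from left to right. *)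

(* Defs.v *)
From HB Require Import structures.
From mathcomp Require Import all_boot all_order all_algebra.
From mathcomp Require Import all_classical all_reals all_analysis.
From mathcomp Require Import complex.

Set Implicit Arguments.
Unset Strict Implicit.
Unset Printing Implicit Defensive.

Import Order.TTheory GRing.Theory Num.Theory.
Import numFieldNormedType.Exports.

Local Open Scope classical_set_scope.
Local Open Scope complex_scope.
Local Open Scope sesquilinear_scope.
Local Open Scope ring_scope.

Section ComplexCalculus.
Context {R : realType}.
Local Notation C := R[i].
Local Notation Re := (@complex.Re R).
Local Notation Im := (@complex.Im R).

Definition cmod (z : C) : R := Re `|z|.

Definition cexpi (t : R) : C := cos t +i* sin t.

Definition cderiven (n : nat) (f : R -> C) (x : R) : C :=
  derive1n n (Re \o f) x +i* derive1n n (Im \o f) x.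

Definition csmooth (f : R -> C) : Prop := forall n x,
  derivable (derive1n n (Re \o f)) x 1 /\
  derivable (derive1n n (Im \o f)) x 1.

Definition cintegral (f : R -> C) : C :=
  Rintegral lebesgue_measure setT (Re \o f) +i*
  Rintegral lebesgue_measure setT (Im \o f).

Definition clim (u : nat -> C) : C :=
  lim ((Re \o u) n @[n --> \oo]) +i*
  lim ((Im \o u) n @[n --> \oo]).

End ComplexCalculus.

(* Distributions are represented by functionals on all functions R -> C, of
   which only the values on Schwartz functions matter.  Duality is bilinear. *)
Section TemperedDistributions.
Context {R : realType}.
Local Notation C := R[i].

Definition schwartz_weight (a b : nat) (f : R -> C) (x : R) : R :=
  `|x| ^+ a * cmod (cderiven b f x).

Definition schwartz (f : R -> C) : Prop :=
  csmooth f /\ forall a b, has_ubound (range (schwartz_weight a b f)).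

Definition schwartz_seminorm (a b : nat) (f : R -> C) : R :=
  sup (range (schwartz_weight a b f)).

Definition functional := (R -> C) -> C.

(* Membership in S'(R): linearity, and continuity for the topology defined by
   the Schwartz seminorms. *)
Definition tempered (u : functional) : Prop :=
  (forall (c : C) (f g : R -> C), schwartz f -> schwartz g ->
     u (fun x => c * f x + g x) = c * u f + u g) /\
  exists (M : R) (N : nat), forall f, schwartz f ->
    cmod (u f) <= M * \sum_(a < N) \sum_(b < N) schwartz_seminorm a b f.

Definition fun_support (f : R -> C) : set R := closure [set x | f x != 0].

Definition vanishes_on (u : functional) (U : set R) : Prop :=
  forall f, csmooth f -> compact (fun_support f) -> fun_support f `<=` U ->
    u f = 0.

Definition dist_support (u : functional) : set R :=
  ~` [set x | exists2 U, open U /\ U x & vanishes_on u U].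

Definition compactly_supported (u : functional) : Prop :=
  compact (dist_support u).

Definition regular_dist (g : R -> C) : functional :=
  fun f => cintegral (fun x => g x * f x).

Definition dist_derive (u : functional) : functional :=
  fun f => - u (cderiven 1 f).

(* u(2 . - k) *)
Definition dist_dilate (k : int) (u : functional) : functional :=
  fun f => 2^-1 * u (fun x => f ((x + k%:~R) / 2)).

Definition fun_ifourier (f : R -> C) (x : R) : C :=
  ((Num.sqrt (2 * pi))^-1)%:C * cintegral (fun xi => f xi * cexpi (x * xi)).

Definition dist_ifourier (u : functional) : functional :=
  fun f => u (fun_ifourier f).

End TemperedDistributions.

Section Symbols.
Context {R : realType}.
Local Notation C := R[i].

Definition scalar_symbol (c : int -> R) (z : C) : C :=
  2^-1 * \sum_(k \in [set: int]) ((c k)%:C * z ^ k).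

Definition matrix_symbol (n : nat) (A : int -> 'M[C]_n) (z : C) : 'M[C]_n :=
  2^-1 *: \sum_(k \in [set: int]) (z ^ k *: A k).

Definition finitely_supported (V : nmodType) (c : int -> V) : Prop :=
  finite_set [set k | c k != 0].

Definition cdf_dual_symbol (m mt : nat) (z : C) : C :=
  let K := ((m + mt)./2)%N in
  z ^- (mt./2) * ((1 + z) / 2) ^+ mt *
  \sum_(n < K) 'C(K.-1 + n, n)%:R * ((2 - z - z^-1) / 4) ^+ n.

Definition spline_mask (m : nat) (k : int) : C :=
  if - (m./2)%:Z <= k <= (uphalf m)%:Z then
    2 ^ (1 - m%:Z) * 'C(m, absz (k + (m./2)%:Z))%:R
  else 0.

(* Indices are shifted to start at 0: row i and column j stand for q = i + 1
   and l = j + 1.  The binomial coefficient annihilates the entries j > i. *)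
Definition quark_mask (m p : nat) (k : int) : 'M[C]_p.+1 :=
  \matrix_(i, j)
    (2 ^- i * (uphalf m)%:R ^ (j%:Z - i%:Z) * spline_mask m k *
     'C(i, j)%:R * k%:~R ^ (i%:Z - j%:Z)).

Definition transition_matrix (m p : nat) (b : int -> R) (z : C) : 'M[C]_p.+1 :=
  scalar_symbol b (- z) *: matrix_symbol (quark_mask m p) z -
  scalar_symbol b z *: matrix_symbol (quark_mask m p) (- z).

Definition is_wavelet_mask (m mt : nat) (b : int -> R) : Prop :=
  finitely_supported b /\
  forall z : C, `|z| = 1 ->
    scalar_symbol b z = - z * (cdf_dual_symbol m mt (- z))^*.

Definition is_dual_quark_mask (m p : nat) (b : int -> R)
    (At : int -> 'M[C]_p.+1) : Prop :=
  finitely_supported At /\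
  forall z : C, `|z| = 1 ->
    (matrix_symbol At z)^t* =
    scalar_symbol b (- z) *: invmx (transition_matrix m p b z).

Definition is_dual_quarklet_mask (m p : nat) (b : int -> R)
    (Bt : int -> 'M[C]_p.+1) : Prop :=
  finitely_supported Bt /\
  forall z : C, `|z| = 1 ->
    (matrix_symbol Bt z)^t* =
    - (invmx (transition_matrix m p b z) *m matrix_symbol (quark_mask m p) (- z)).

End Symbols.

Section DualQuarklets.
Context {R : realType} {p : nat}.
Local Notation C := R[i].

(* prod_{j >= 1} 2^-p At(e^{-i 2^-j xi}) v, as an entrywise limit of the
   partial products; the ring product over 'M_p.+1 is ordered left to right. *)
Definition refinement_product (At : int -> 'M[C]_p.+1) (v : 'cV[C]_p.+1)
    (xi : R) : 'cV[C]_p.+1 :=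
  \col_l clim (fun n =>
    ((\prod_(1 <= j < n.+1)
        (2 ^- p *: matrix_symbol At (cexpi (- (2 ^- j * xi))))) *m v) l 0).

Definition dual_quark (At : int -> 'M[C]_p.+1) (v : 'cV[C]_p.+1)
    (l : 'I_p.+1) : @functional R :=
  iter p dist_derive
    (dist_ifourier (regular_dist (fun xi => refinement_product At v xi l 0))).

Definition dual_quarklet (At Bt : int -> 'M[C]_p.+1) (v : 'cV[C]_p.+1)
    (q : 'I_p.+1) : @functional R :=
  fun f => \sum_(k \in [set: int]) \sum_(l < p.+1)
    Bt k q l * dist_dilate k (dual_quark At v l) f.

End DualQuarklets.

(* Main.v *)
Require Import Defs.
From mathcomp Require Import all_boot all_order all_algebra.
From mathcomp Require Import all_classical all_reals all_analysis.
From mathcomp Require Import complex measurable_realfun zify ring lra.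

Set Implicit Arguments.
Unset Strict Implicit.
Unset Printing Implicit Defensive.

Import Order.TTheory GRing.Theory Num.Theory.
Import numFieldNormedType.Exports.

Local Open Scope classical_set_scope.
Local Open Scope complex_scope.
Local Open Scope ring_scope.

(** A dual quarklet is a finite combination of dilates of dual quarks, and a dual
    quark is the p-th derivative of the inverse Fourier transform of a function F,
    the limit of the products

      F_k(s) = M(s/2) M(s/4) ... M(s/2^k) v,   M(s) = 2^-p At(exp(-i s)).

    Being tempered and vanishing outside an interval are both stable under
    differentiation, dilation and finite sums, so all depends on F.  Two things
    are needed: F grows at most polynomially, and its inverse Fourier transform
    is supported in an interval.

    Growth.  The symbol of the wavelet mask satisfies b(1) = 0 and
    b(-1) = 1, hence the transition matrix at 1 is the symbol of the quark mask,
    a lower triangular matrix with diagonal entries 2^-i ([quark_symbol1]).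
    Therefore M(0) is upper triangular with diagonal entries 2^(i-p) in ]0, 1]
    ([refinement_factor0_triangular]).  In a suitably weighted norm M(s) then has
    norm at most 3/2 near 0, and as M(0) v = v the increments F_(k+1) - F_k are
    O((3/4)^k) there.  The relation F_(k+1)(s) = M(s/2) F_k(s/2) extends
    convergence to all s and yields a bound of order |s|^L, uniform in k
    ([partial_vector_limits]).  A function of polynomial growth has a tempered
    inverse Fourier transform ([tempered_ifourier]), because Fourier integrals
    of Schwartz functions decay faster than any power, with constants bounded by
    seminorms ([fourier_int_decay], by integration by parts).

    Support.  Each F_k is a trigonometric polynomial, with frequencies in an
    interval [-N, N] that does not depend on k because N/2 + N/2 = N
    ([partial_vector_trig]).  Its inverse Fourier transform is thus a sum of
    point masses in [-N, N], and kills every test function that vanishes near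
    [-N, N].  For this, Fourier inversion is needed only at points near which
    the test function vanishes, where it follows from the fundamental theorem of
    calculus ([fourier_inversion_vanishing]).  Dominated convergence transfers
    the vanishing to F ([vanishes_outside_ifourier]). *)

(** * Complex numbers and complex-valued functions of a real variable *)

Section ComplexModulus.
Context {R : realType}.
Local Notation C := R[i].
Local Notation Re := (@complex.Re R).
Local Notation Im := (@complex.Im R).
Implicit Types (x y z : C) (t : R).

Lemma complex_eq x y : Re x = Re y -> Im x = Im y -> x = y.
Proof. by case: x => a b; case: y => c d /= -> ->. Qed.

Lemma creD x y : Re (x + y) = Re x + Re y. Proof. by case: x; case: y. Qed.
Lemma cimD x y : Im (x + y) = Im x + Im y. Proof. by case: x; case: y. Qed.
Lemma creM x y : Re (x * y) = Re x * Re y - Im x * Im y.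
Proof. by case: x; case: y. Qed.
Lemma cimM x y : Im (x * y) = Re x * Im y + Im x * Re y.
Proof. by case: x => a b; case: y => c d; rewrite /= [b * c]mulrC. Qed.
Lemma creN x : Re (- x) = - Re x. Proof. by case: x. Qed.
Lemma cimN x : Im (- x) = - Im x. Proof. by case: x. Qed.

Lemma cmodE z : cmod z = Num.sqrt (Re z ^+ 2 + Im z ^+ 2).
Proof. by rewrite /cmod normc_def. Qed.

Lemma cmod_ge0 z : 0 <= cmod z. Proof. by rewrite cmodE sqrtr_ge0. Qed.

Lemma normc_cmod z : `|z| = (cmod z)%:C.
Proof. by rewrite /cmod normc_def. Qed.

Lemma cmodM x y : cmod (x * y) = cmod x * cmod y.
Proof. by apply: complexI; rewrite rmorphM -!normc_cmod normrM. Qed.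

Lemma cmodN x : cmod (- x) = cmod x.
Proof. by rewrite /cmod normrN. Qed.

Lemma cmodD x y : cmod (x + y) <= cmod x + cmod y.
Proof. by rewrite -lecR rmorphD -!normc_cmod ler_normD. Qed.

Lemma cmodC t : cmod t%:C = `|t|.
Proof. by rewrite cmodE /= expr0n addr0 sqrtr_sqr. Qed.

Lemma cmod0 : cmod (0 : C) = 0. Proof. by rewrite /cmod normr0. Qed.
Lemma cmod1 : cmod (1 : C) = 1. Proof. by rewrite /cmod normr1. Qed.

Lemma cmodX x n : cmod (x ^+ n) = cmod x ^+ n.
Proof. by elim: n => [|n ih]; rewrite ?expr0 ?cmod1// !exprS cmodM ih. Qed.

Lemma cmod_nat n : cmod (n%:R : C) = n%:R.
Proof. by rewrite -(rmorph_nat (real_complex R)) cmodC ger0_norm. Qed.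

Lemma cmodV x : cmod x^-1 = (cmod x)^-1.
Proof.
by apply: complexI; rewrite fmorphV -!normc_cmod normfV.
Qed.

Lemma cmod_sum (I : Type) (r : seq I) (P : pred I) (F : I -> C) :
  cmod (\sum_(i <- r | P i) F i) <= \sum_(i <- r | P i) cmod (F i).
Proof.
elim/big_rec2: _ => [|i y x _ yx]; first by rewrite cmod0.
by rewrite (le_trans (cmodD _ _))// lerD2l.
Qed.

Lemma normRe_cmod z : `|Re z| <= cmod z.
Proof. by rewrite cmodE -sqrtr_sqr ler_wsqrtr// lerDl sqr_ge0. Qed.

Lemma normIm_cmod z : `|Im z| <= cmod z.
Proof. by rewrite cmodE -sqrtr_sqr ler_wsqrtr// lerDr sqr_ge0. Qed.

Lemma cmod_ReIm z : cmod z <= `|Re z| + `|Im z|.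
Proof.
rewrite -ler_sqr ?nnegrE ?cmod_ge0 ?addr_ge0// cmodE sqr_sqrtr ?addr_ge0 ?sqr_ge0//.
by rewrite sqrrD !real_normK ?num_real// addrAC lerDl mulrn_wge0// mulr_ge0.
Qed.

Lemma cmod_cexpi t : cmod (cexpi t) = 1.
Proof. by rewrite cmodE /= cos2Dsin2 sqrtr1. Qed.

Lemma cexpi0 : cexpi (0 : R) = 1.
Proof. by rewrite /cexpi cos0 sin0. Qed.

Lemma cexpiD s t : cexpi (s + t : R) = cexpi s * cexpi t.
Proof.
by apply: complex_eq; rewrite ?creM ?cimM/= ?cosD ?sinD// [RHS]addrC.
Qed.

Lemma cexpiN t : cexpi (- t : R) = (cexpi t)^-1.
Proof.
have h : cexpi (- t) * cexpi t = 1 by rewrite -cexpiD addNr cexpi0.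
have n0 : cexpi t != 0.
  by apply/eqP => e; have := cmod_cexpi t; rewrite e cmod0 => /eqP; rewrite eq_sym oner_eq0.
by rewrite -[LHS](mulfK n0) h mul1r.
Qed.

Lemma cexpiMz t (k : int) : cexpi t ^ k = cexpi (k%:~R * t : R).
Proof.
have hn (n : nat) : cexpi t ^+ n = cexpi (n%:R * t).
  elim: n => [|n ih]; first by rewrite expr0 mul0r cexpi0.
  by rewrite exprS ih -cexpiD -{1}[t]mul1r -mulrDl nat1r.
case: k => n; first exact: hn.
by rewrite NegzE -exprnN hn -cexpiN mulrNz mulNr.
Qed.

End ComplexModulus.

Section ComplexValuedFunctions.
Context {R : realType}.
Local Notation C := R[i].
Local Notation Re := (@complex.Re R).
Local Notation Im := (@complex.Im R).
Implicit Types (f g : R -> C).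

(** Topological notions for functions into [R[i]] are taken componentwise, so
    that the real analysis applies to each component. *)
Definition ccontinuous f := continuous (Re \o f) /\ continuous (Im \o f).

Definition cis_derive f f' := forall x : R,
  is_derive x 1 (Re \o f) (Re (f' x)) /\ is_derive x 1 (Im \o f) (Im (f' x)).

Lemma ccontinuous_cst (c : C) : ccontinuous (fun=> c).
Proof. by split=> x; exact: cvg_cst. Qed.

Lemma ccontinuousD f g : ccontinuous f -> ccontinuous g ->
  ccontinuous (fun x => f x + g x).
Proof.
move=> [f1 f2] [g1 g2]; split=> x.
- rewrite (_ : Re \o _ = (Re \o f) \+ (Re \o g)); last by apply/funext => y /=; rewrite creD.
  by apply: continuousD; [exact: f1|exact: g1].
- rewrite (_ : Im \o _ = (Im \o f) \+ (Im \o g)); last by apply/funext => y /=; rewrite cimD.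
  by apply: continuousD; [exact: f2|exact: g2].
Qed.

Lemma ccontinuousM f g : ccontinuous f -> ccontinuous g ->
  ccontinuous (fun x => f x * g x).
Proof.
move=> [f1 f2] [g1 g2]; split=> x.
- rewrite (_ : Re \o _ = (Re \o f) \* (Re \o g) \- (Im \o f) \* (Im \o g)); last first.
    by apply/funext => y /=; rewrite creM.
  by apply: continuousB; apply: continuousM; by [exact: f1|exact: f2|exact: g1|exact: g2].
- rewrite (_ : Im \o _ = (Re \o f) \* (Im \o g) \+ (Im \o f) \* (Re \o g)); last first.
    by apply/funext => y /=; rewrite cimM.
  by apply: continuousD; apply: continuousM; by [exact: f1|exact: f2|exact: g1|exact: g2].
Qed.

Lemma cis_derive_continuous f f' : cis_derive f f' -> ccontinuous f.
Proof.
move=> df; split=> x; apply: differentiable_continuous; apply/derivable1_diffP;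
by have [[? _] [? _]] := df x.
Qed.

Lemma cis_deriveD f g f' g' : cis_derive f f' -> cis_derive g g' ->
  cis_derive (fun x => f x + g x) (fun x => f' x + g' x).
Proof.
move=> df dg x; have [f1 f2] := df x; have [g1 g2] := dg x; split.
- rewrite creD (_ : Re \o _ = (Re \o f) \+ (Re \o g)); last by apply/funext => y /=; rewrite creD.
  exact: is_deriveD.
- rewrite cimD (_ : Im \o _ = (Im \o f) \+ (Im \o g)); last by apply/funext => y /=; rewrite cimD.
  exact: is_deriveD.
Qed.

Lemma cis_deriveM f g f' g' : cis_derive f f' -> cis_derive g g' ->
  cis_derive (fun x => f x * g x) (fun x => f' x * g x + f x * g' x).
Proof.
move=> df dg x; have [f1 f2] := df x; have [g1 g2] := dg x; split.
- rewrite (_ : Re \o _ = (Re \o f) \* (Re \o g) \- (Im \o f) \* (Im \o g)); last first.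
    by apply/funext => y /=; rewrite creM.
  apply: (is_derive_eq (is_deriveB (is_deriveM f1 g1) (is_deriveM f2 g2))).
  rewrite creD !creM /GRing.scale/=; ring.
- rewrite (_ : Im \o _ = (Re \o f) \* (Im \o g) \+ (Im \o f) \* (Re \o g)); last first.
    by apply/funext => y /=; rewrite cimM.
  apply: (is_derive_eq (is_deriveD (is_deriveM f1 g2) (is_deriveM f2 g1))).
  rewrite cimD !cimM /GRing.scale/=; ring.
Qed.

Lemma cis_derive_cst (c : C) : cis_derive (fun=> c) (fun=> 0).
Proof. by move=> x; split; exact: is_derive_cst. Qed.

Lemma cis_derive_cexpi_l (a : R) :
  cis_derive (fun x => cexpi (a * x)) (fun x => 'i * a%:C * cexpi (a * x)).
Proof.
move=> x.
have dlin : is_derive x 1 (fun x : R => a * x) a.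
  apply: is_derive_eq; rewrite /GRing.scale/=; ring.
split.
- apply: (is_derive_eq (is_derive1_comp (is_derive_cos _) dlin)).
  by rewrite !creM !cimM /=; ring.
- apply: (is_derive_eq (is_derive1_comp (is_derive_sin _) dlin)).
  by rewrite !(creM, cimM) /=; ring.
Qed.

Lemma cis_derive_cexpi_r (a : R) :
  cis_derive (fun x => cexpi (x * a)) (fun x => 'i * a%:C * cexpi (x * a)).
Proof.
rewrite (_ : (fun x => cexpi (x * a)) = (fun x => cexpi (a * x))); last first.
  by apply/funext => x; rewrite mulrC.
by move=> x; rewrite [x * a]mulrC; exact: cis_derive_cexpi_l.
Qed.

Lemma ccontinuous_cexpi_l (a : R) : ccontinuous (fun x => cexpi (a * x)).
Proof. exact: cis_derive_continuous (@cis_derive_cexpi_l a). Qed.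

Lemma ccontinuous_cexpi_r (a : R) : ccontinuous (fun x => cexpi (x * a)).
Proof. exact: cis_derive_continuous (@cis_derive_cexpi_r a). Qed.

Lemma ccontinuous_real (f : R -> R) : continuous f -> ccontinuous (fun x => (f x)%:C).
Proof. by move=> cf; split=> x; [exact: cf|exact: cvg_cst]. Qed.

End ComplexValuedFunctions.

(** * Integrals of functions with quadratic decay *)

Section QuadraticDecay.
Context {R : realType}.
Local Notation mu := (@lebesgue_measure R).
Implicit Types (f g F : R -> R) (K : R).

(** The majorant of all integrands below: integrable, and bounding up to a
    constant every continuous function [f] such that [f x] and [x ^+ 2 * f x] are bounded. *)
Definition invquad (x : R) : R := (oneDsqr x)^-1.

Lemma invquad_ge0 x : 0 <= invquad x.
Proof. by rewrite invr_ge0. Qed.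

Lemma continuous_invquad : continuous invquad.
Proof. exact: continuous_oneDsqrV. Qed.

Lemma integrable_invquad : mu.-integrable [set: R] (EFin \o invquad).
Proof.
have mi : measurable_fun [set: R] (fun x => (invquad x)%:E).
  apply/measurable_EFinP; apply: continuous_measurable_fun.
  exact: continuous_invquad.
apply/integrableP; split => //.
have -> : (\int[mu]_x `|(EFin \o invquad) x| = \int[mu]_x (invquad x)%:E)%E.
  by apply: eq_integral => x _ /=; rewrite ger0_norm ?invquad_ge0.
rewrite ge0_symfun_integralT; last 3 first.
- exact: invquad_ge0.
- exact: continuous_invquad.
- by move=> x /=; rewrite /invquad /oneDsqr sqrrN.
rewrite (_ : [set x | _] = `[0, +oo[%classic); last first.
  by apply/seteqP; split => x/=; rewrite in_itv/= andbT.
by rewrite integral0y_oneDsqr -EFinM ltry.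
Qed.

Lemma integrable_quad_decay f K : measurable_fun [set: R] f ->
  (forall x, `|f x| <= K * invquad x) -> mu.-integrable [set: R] (EFin \o f).
Proof.
move=> mf fK; apply: (@le_integrable _ _ _ mu _ measurableT _ (EFin \o (fun x => K * invquad x))).
- exact/measurable_EFinP.
- move=> x _ /=; rewrite lee_fin (le_trans (fK x))// ler_norm//.
- exact: (integrableZl measurableT K integrable_invquad).
Qed.

Definition quad_mass : R := (\int[mu]_x invquad x)%R.

Lemma le_quad_decay f K : measurable_fun [set: R] f ->
  (forall x, `|f x| <= K * invquad x) ->
  `|(\int[mu]_x f x)%R| <= K * quad_mass.
Proof.
move=> mf fK; have If := integrable_quad_decay mf fK.
have Iq := integrable_invquad.
apply: (le_trans (le_normr_Rintegral _ If)) => //.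
rewrite -RintegralZl//; apply: le_Rintegral => //.
- exact: integrable_norm.
- exact: (integrableZl measurableT K Iq).
Qed.

Lemma quad_mass_ge0 : 0 <= quad_mass.
Proof. by apply: Rintegral_ge0 => x _; exact: invquad_ge0. Qed.

Lemma dominated_convergence_quad (f_ : nat -> R -> R) f K :
  (forall n, measurable_fun [set: R] (f_ n)) ->
  (forall n x, `|f_ n x| <= K * invquad x) ->
  (forall x, f_ n x @[n --> \oo] --> f x) ->
  (\int[mu]_x f_ n x)%R @[n --> \oo] --> (\int[mu]_x f x)%R.
Proof.
move=> mf fK ff.
have mF : measurable_fun [set: R] f.
  by apply: (measurable_fun_cvg mf) => x _; exact: ff.
have ff' x : (f_ n x)%:E @[n --> \oo] --> (f x)%:E.
  by apply/fine_cvgP; split; [exact: nearW|exact: ff].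
have [|||||If _ cvI] := @dominated_convergence _ _ _ mu [set: R] measurableT
  (fun n x => (f_ n x)%:E) (fun x => (f x)%:E) (fun x => (K * invquad x)%:E).
- by move=> n; apply/measurable_EFinP; exact: mf.
- by apply/measurable_EFinP; exact: mF.
- by apply: aeW => x _; exact: ff'.
- exact: (integrableZl measurableT K integrable_invquad).
- by apply: aeW => x n _; rewrite /= lee_fin.
by apply: fine_cvg; rewrite fineK; [exact: cvI|exact: integrable_fin_num].
Qed.

(** The integral over [-n, n] is [F n - F (- n)], which tends to 0 because
    [x * F x] is bounded; dominated convergence gives the integral over R. *)
Lemma Rintegral_derivative_eq0 F f K L :
  (forall x : R, is_derive x 1 F (f x)) -> continuous f ->
  (forall x, `|f x| <= K * invquad x) -> (forall x, `|x| * `|F x| <= L) ->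
  (\int[mu]_x f x)%R = 0.
Proof.
move=> dF cf fK FL.
have mf : measurable_fun [set: R] f by exact: continuous_measurable_fun.
have cF x : {for x, continuous F}.
  by apply/differentiable_continuous/derivable1_diffP; have [] := dF x.
pose f_ n := f \_ `[- n.+1%:R, n.+1%:R].
have f_E n : (\int[mu]_x f_ n x)%R = F n.+1%:R - F (- n.+1%:R).
  rewrite -Rintegral_mkcond /Rintegral (@continuous_FTC2 _ f F) //.
  - exact: gtrN.
  - by apply: continuous_subspaceT.
  - split.
    + by move=> x _; have [] := dF x.
    + by apply: cvg_at_right_filter; exact: cF.
    + by apply: cvg_at_left_filter; exact: cF.
  - by move=> x _; rewrite derive1E; have [_ ->] := dF x.
have h1 : (\int[mu]_x f_ n x)%R @[n --> \oo] --> (\int[mu]_x f x)%R.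
  apply: (@dominated_convergence_quad _ _ K).
  - move=> n; apply/(measurable_restrictT _ _).1 => //.
    exact: measurable_funTS.
  - move=> n x; rewrite /f_ patchE; case: ifP => _; first exact: fK.
    by rewrite normr0 (le_trans _ (fK x)).
  - move=> x; apply: cvg_near_cst.
    near=> n; rewrite /f_ patchE ifT// inE/= in_itv/= -ler_norml.
    rewrite (@le_trans _ _ n%:R)// ?ler_nat//; near: n.
    exact: nbhs_infty_ger.
have h2 : (\int[mu]_x f_ n x)%R @[n --> \oo] --> (0:R).
  have hb : (L + L) * n.+1%:R^-1 @[n --> \oo] --> (0:R).
    by rewrite -(mulr0 (L + L)); apply: cvgMr; exact: cvg_harmonic.
  apply: norm_cvg0; apply: (squeeze_cvgr _ (cvg_cst 0) hb).
  apply: nearW => n /=; rewrite normr_ge0/= f_E.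
  rewrite ler_pdivlMr ?ltr0n// (le_trans (ler_wpM2r _ (ler_normB _ _)))//.
  have := FL n.+1%:R; have := FL (- n.+1%:R).
  by rewrite normrN [`|n.+1%:R|]ger0_norm// mulrDl ![_ * n.+1%:R]mulrC => *; exact: lerD.
exact: (cvg_unique _ h1 h2).
Unshelve. all: by end_near. Qed.

End QuadraticDecay.

Section ComplexIntegrals.
Context {R : realType}.
Local Notation C := R[i].
Local Notation Re := (@complex.Re R).
Local Notation Im := (@complex.Im R).
Local Notation mu := (@lebesgue_measure R).
Implicit Types (f g F : R -> C) (K L : R).

Definition cmeasurable f :=
  measurable_fun [set: R] (Re \o f) /\ measurable_fun [set: R] (Im \o f).

Definition quad_decay K f := forall x, cmod (f x) <= K * invquad x.

Lemma ccontinuous_measurable f : ccontinuous f -> cmeasurable f.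
Proof. by move=> [c1 c2]; split; exact: continuous_measurable_fun. Qed.

Lemma cmeasurableM f g : cmeasurable f -> cmeasurable g ->
  cmeasurable (fun x => f x * g x).
Proof.
move=> [f1 f2] [g1 g2]; split.
- rewrite (_ : Re \o _ = (Re \o f) \* (Re \o g) \- (Im \o f) \* (Im \o g)); last first.
    by apply/funext => y /=; rewrite creM.
  by apply: measurable_funB; exact: measurable_funM.
- rewrite (_ : Im \o _ = (Re \o f) \* (Im \o g) \+ (Im \o f) \* (Re \o g)); last first.
    by apply/funext => y /=; rewrite cimM.
  by apply: measurable_funD; exact: measurable_funM.
Qed.

Lemma quad_decay_Re K f : quad_decay K f -> forall x, `|Re (f x)| <= K * invquad x.
Proof. by move=> fK x; exact: le_trans (normRe_cmod _) (fK x). Qed.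

Lemma quad_decay_Im K f : quad_decay K f -> forall x, `|Im (f x)| <= K * invquad x.
Proof. by move=> fK x; exact: le_trans (normIm_cmod _) (fK x). Qed.

Lemma quad_decayD K L f g : quad_decay K f -> quad_decay L g ->
  quad_decay (K + L) (fun x => f x + g x).
Proof.
by move=> fK gL x; rewrite mulrDl; apply: le_trans (cmodD _ _) _; exact: lerD.
Qed.

Lemma quad_decayM K L f g : (forall x, cmod (g x) <= L) -> quad_decay K f ->
  quad_decay (L * K) (fun x => g x * f x).
Proof.
by move=> gL fK x; rewrite cmodM -mulrA; apply: ler_pM => //; exact: cmod_ge0.
Qed.

Lemma quad_decayZ K f (c : C) : quad_decay K f ->
  quad_decay (cmod c * K) (fun x => c * f x).
Proof. exact: quad_decayM. Qed.

Lemma cmeasurableZ (c : C) f : cmeasurable f -> cmeasurable (fun x => c * f x).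
Proof.
move=> mf; apply: cmeasurableM => //; apply: ccontinuous_measurable.
exact: ccontinuous_cst.
Qed.

Lemma quad_decay_ge0 K f : quad_decay K f -> 0 <= K.
Proof.
move=> /(_ 0) fK; have : 0 <= K * invquad (0 : R) := le_trans (cmod_ge0 _) fK.
by rewrite pmulr_lge0// invr_gt0 (lt_le_trans ltr01)// oneDsqr_ge1.
Qed.

Lemma integrable_Re K f : cmeasurable f -> quad_decay K f ->
  mu.-integrable [set: R] (EFin \o (Re \o f)).
Proof. by move=> [m1 _] /quad_decay_Re; exact: integrable_quad_decay. Qed.

Lemma integrable_Im K f : cmeasurable f -> quad_decay K f ->
  mu.-integrable [set: R] (EFin \o (Im \o f)).
Proof. by move=> [_ m2] /quad_decay_Im; exact: integrable_quad_decay. Qed.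

Lemma cmod_cintegral K f : cmeasurable f -> quad_decay K f ->
  cmod (cintegral f) <= K * (2 * quad_mass).
Proof.
move=> [m1 m2] fK; apply: le_trans (cmod_ReIm _) _.
rewrite [2 * _]mulr_natl mulr2n mulrDr; apply: lerD => /=.
- by apply: le_quad_decay => //; exact: quad_decay_Re.
- by apply: le_quad_decay => //; exact: quad_decay_Im.
Qed.

Lemma cintegralD K L f g : cmeasurable f -> cmeasurable g ->
  quad_decay K f -> quad_decay L g ->
  cintegral (fun x => f x + g x) = cintegral f + cintegral g.
Proof.
move=> mf mg fK gL; apply: complex_eq; rewrite ?creD ?cimD /=.
- rewrite -RintegralD//; [|exact: integrable_Re fK|exact: integrable_Re gL].
  by apply: eq_Rintegral => x _ /=; rewrite creD.
- rewrite -RintegralD//; [|exact: integrable_Im fK|exact: integrable_Im gL].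
  by apply: eq_Rintegral => x _ /=; rewrite cimD.
Qed.

Lemma cintegralZ K (c : C) f : cmeasurable f -> quad_decay K f ->
  cintegral (fun x => c * f x) = c * cintegral f.
Proof.
move=> mf fK.
have If1 := integrable_Re mf fK; have If2 := integrable_Im mf fK.
have Z1 (a : R) : mu.-integrable [set: R] (EFin \o (fun x => a * Re (f x))).
  exact: (integrableZl measurableT a If1).
have Z2 (a : R) : mu.-integrable [set: R] (EFin \o (fun x => a * Im (f x))).
  exact: (integrableZl measurableT a If2).
apply: complex_eq; rewrite ?creM ?cimM /=.
- rewrite -!RintegralZl// -RintegralB//.
  by apply: eq_Rintegral => x _ /=; rewrite creM.
- rewrite -!RintegralZl// -RintegralD//.
  by apply: eq_Rintegral => x _ /=; rewrite cimM.
Qed.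

Lemma cintegral_cvg (f_ : nat -> R -> C) f K :
  (forall n, cmeasurable (f_ n)) -> (forall n, quad_decay K (f_ n)) ->
  (forall x, Re (f_ n x) @[n --> \oo] --> Re (f x)) ->
  (forall x, Im (f_ n x) @[n --> \oo] --> Im (f x)) ->
  Re (cintegral (f_ n)) @[n --> \oo] --> Re (cintegral f) /\
  Im (cintegral (f_ n)) @[n --> \oo] --> Im (cintegral f).
Proof.
move=> mf fK r i; split.
- apply: (@dominated_convergence_quad _ (fun n => Re \o f_ n) _ K) => //.
  + by move=> n; have [] := mf n.
  + by move=> n; exact: quad_decay_Re.
- apply: (@dominated_convergence_quad _ (fun n => Im \o f_ n) _ K) => //.
  + by move=> n; have [] := mf n.
  + by move=> n; exact: quad_decay_Im.
Qed.

Lemma cintegral_derivative_eq0 F f K L :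
  cis_derive F f -> ccontinuous f -> quad_decay K f ->
  (forall x, `|x| * cmod (F x) <= L) -> cintegral f = 0.
Proof.
move=> dF [c1 c2] fK FL; apply: complex_eq => /=.
- apply: (@Rintegral_derivative_eq0 _ (Re \o F) _ K L) => //.
  + by move=> x; have [] := dF x.
  + exact: quad_decay_Re.
  + move=> x; apply: le_trans (FL x).
    by rewrite ler_wpM2l//; exact: normRe_cmod.
- apply: (@Rintegral_derivative_eq0 _ (Im \o F) _ K L) => //.
  + by move=> x; have [] := dF x.
  + exact: quad_decay_Im.
  + move=> x; apply: le_trans (FL x).
    by rewrite ler_wpM2l//; exact: normIm_cmod.
Qed.

Section ParametricIntegral.
Variables (h h' : R -> R -> C) (K : R).
Hypothesis mh : forall s, cmeasurable (h s).

Lemma ccontinuous_cintegral : (forall s, quad_decay K (h s)) ->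
  (forall x, ccontinuous (h ^~ x)) -> ccontinuous (fun s => cintegral (h s)).
Proof.
move=> hK' ch; split=> a.
- apply: (@continuity_under_integral _ _ _ mu (fun s x => Re (h s x))
     setT measurableT (a - 1) (a + 1) _ _ (fun x => K * invquad x)).
  + by move=> s _; exact: integrable_Re (mh s) (hK' s).
  + by apply: aeW => x _ s _; have [c1 _] := ch x; exact: c1.
  + exact: (integrableZl measurableT K integrable_invquad).
  + by move=> s _; apply: aeW => x _; exact: quad_decay_Re.
  + by rewrite inE /= in_itv/= ltrBlDr ltrDl ltr01.
- apply: (@continuity_under_integral _ _ _ mu (fun s x => Im (h s x))
     setT measurableT (a - 1) (a + 1) _ _ (fun x => K * invquad x)).
  + by move=> s _; exact: integrable_Im (mh s) (hK' s).
  + by apply: aeW => x _ s _; have [_ c1] := ch x; exact: c1.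
  + exact: (integrableZl measurableT K integrable_invquad).
  + by move=> s _; apply: aeW => x _; exact: quad_decay_Im.
  + by rewrite inE /= in_itv/= ltrBlDr ltrDl ltr01.
Qed.

Hypothesis hK : forall s, exists L, quad_decay L (h s).

(** Differentiation under the integral sign: the derivative needs a majorant
    common to all parameters, the integrand only one for each parameter. *)
Lemma cis_derive_cintegral : (forall s, quad_decay K (h' s)) ->
  (forall x, cis_derive (h ^~ x) (h' ^~ x)) ->
  cis_derive (fun s => cintegral (h s)) (fun s => cintegral (h' s)).
Proof.
move=> hK' dh.
have real_case (g g' : R -> R -> R^o) (a : R) :
  (forall s, mu.-integrable [set: R] (EFin \o g s)) ->
  (forall s x : R, is_derive s 1 (g ^~ x) (g' s x)) ->
  (forall s x, `|g' s x| <= K * invquad x) ->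
  is_derive a 1 (fun s => \int[mu]_x g s x)%R (\int[mu]_x g' a x)%R.
  move=> ig dg gK.
  have d1g s x : partial1of2 g s x = g' s x.
    by rewrite partial1of2E; have [_ ->] := dg s x.
  have Ia : `]a - 1, a + 1[%classic a by rewrite /= in_itv/= ltrBlDr ltrDl ltr01.
  have K0 : 0 <= K by exact: quad_decay_ge0 (hK' 0).
  have G0 (x : R) : 0 <= K * invquad x by rewrite mulr_ge0// invquad_ge0.
  have IG := integrableZl measurableT K (@integrable_invquad R).
  have dgx (s x : R) : `]a - 1, a + 1[%classic s -> [set: R] x -> derivable (g ^~ x) s 1.
    by move=> _ _; have [] := dg s x.
  have gub (s x : R) : `]a - 1, a + 1[%classic s -> [set: R] x ->
      `|partial1of2 g s x| <= K * invquad x.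
    by move=> _ _; rewrite d1g.
  have e1 := @derivable_under_integral _ _ _ mu g setT measurableT a (a - 1) (a + 1)
    Ia (fun s _ => ig s) dgx (fun x => K * invquad x) G0 IG gub.
  have e2 := @differentiation_under_integral _ _ _ mu g setT measurableT a (a - 1) (a + 1)
    Ia (fun s _ => ig s) dgx (fun x => K * invquad x) G0 IG gub.
  apply: DeriveDef => //; rewrite -derive1E e2.
  by apply: eq_Rintegral => x _; rewrite d1g.
move=> a; split.
- apply: (real_case (fun s x => Re (h s x)) (fun s x => Re (h' s x))).
  + by move=> s; have [L hL] := hK s; exact: integrable_Re (mh s) hL.
  + by move=> s x; have [] := dh x s.
  + by move=> s; exact: quad_decay_Re.
- apply: (real_case (fun s x => Im (h s x)) (fun s x => Im (h' s x))).
  + by move=> s; have [L hL] := hK s; exact: integrable_Im (mh s) hL.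
  + by move=> s x; have [] := dh x s.
  + by move=> s; exact: quad_decay_Im.
Qed.

End ParametricIntegral.
End ComplexIntegrals.

(** * Schwartz functions and the decay of their Fourier integrals *)

Section SchwartzFunctions.
Context {R : realType}.
Local Notation C := R[i].
Implicit Types (f g : R -> C).

Lemma cderiven0 f : cderiven 0 f = f.
Proof. by apply/funext => x; rewrite /cderiven /=; case: (f x). Qed.

Lemma cderivenS n f : cderiven n.+1 f = cderiven 1 (cderiven n f).
Proof. by []. Qed.

Lemma cderivenD m n f : cderiven m (cderiven n f) = cderiven (m + n) f.
Proof. by apply/funext => x; rewrite /cderiven /derive1n !iterD. Qed.

Lemma csmooth_cderiven n f : csmooth f -> csmooth (cderiven n f).
Proof.
move=> sf k x; have := sf (k + n)%N x.
by rewrite /derive1n !iterD.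
Qed.

Lemma csmooth_is_derive f : csmooth f -> cis_derive f (cderiven 1 f).
Proof.
move=> sf x; have [d1 d2] := sf 0 x.
by split; apply: DeriveDef => //; rewrite -derive1E.
Qed.

Lemma csmooth_continuous n f : csmooth f -> ccontinuous (cderiven n f).
Proof.
by move=> /(csmooth_cderiven n)/csmooth_is_derive; exact: cis_derive_continuous.
Qed.

Lemma schwartz_cderiven n f : schwartz f -> schwartz (cderiven n f).
Proof.
move=> [sf hf]; split; first exact: csmooth_cderiven.
move=> a b; rewrite (_ : schwartz_weight a b _ = schwartz_weight a (b + n) f) //.
by apply/funext => x; rewrite /schwartz_weight cderivenD.
Qed.

Lemma schwartz_seminorm_cderiven n a b f :
  schwartz_seminorm a b (cderiven n f) = schwartz_seminorm a (b + n) f.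
Proof.
rewrite /schwartz_seminorm.
rewrite (_ : schwartz_weight a b _ = schwartz_weight a (b + n) f) //.
by apply/funext => x; rewrite /schwartz_weight cderivenD.
Qed.

Lemma schwartz_weight_le a b f x : schwartz f ->
  `|x| ^+ a * cmod (cderiven b f x) <= schwartz_seminorm a b f.
Proof.
move=> [_ /(_ a b) h]; apply: sup_ubound => //.
Qed.

Lemma schwartz_seminorm_ge0 a b f : schwartz f -> 0 <= schwartz_seminorm a b f.
Proof.
move=> sf; apply: le_trans (schwartz_weight_le a b 0 sf).
by rewrite mulr_ge0// ?exprn_ge0// cmod_ge0.
Qed.

Lemma schwartz_seminorm_le a b f (M : R) :
  (forall x, `|x| ^+ a * cmod (cderiven b f x) <= M) -> schwartz_seminorm a b f <= M.
Proof.
move=> h; apply: ge_sup; first by exists (schwartz_weight a b f 0), 0.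
by move=> _ [x _ <-]; exact: h.
Qed.

Definition quad_norm n f : R := schwartz_seminorm 0 n f + schwartz_seminorm 2 n f.

Lemma quad_decay_of_moments (K : R) f :
  (forall x, cmod (f x) + `|x| ^+ 2 * cmod (f x) <= K) -> quad_decay K f.
Proof.
move=> h x; rewrite -ler_pdivrMr ?invr_gt0 ?(lt_le_trans ltr01) ?oneDsqr_ge1//.
rewrite invrK /oneDsqr mulrDr mulr1 mulrC -[x ^+ 2]real_normK ?num_real//.
Qed.

Lemma schwartz_quad_decay n f : schwartz f -> quad_decay (quad_norm n f) (cderiven n f).
Proof.
move=> sf; apply: quad_decay_of_moments => x.
have := schwartz_weight_le 0 n x sf; rewrite expr0 mul1r => h.
by apply: lerD => //; exact: schwartz_weight_le.
Qed.

End SchwartzFunctions.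

Section FourierIntegral.
Context {R : realType}.
Local Notation C := R[i].
Implicit Types (f g : R -> C) (K L : R).

Definition fourier_int f (s : R) : C := cintegral (fun x => f x * cexpi (s * x)).

Lemma fun_ifourierE f s :
  fun_ifourier f s = ((Num.sqrt (2 * pi))^-1)%:C * fourier_int f s.
Proof. by []. Qed.

Lemma fourier_integrand_measurable f s : cmeasurable f ->
  cmeasurable (fun x => f x * cexpi (s * x)).
Proof.
move=> mf; apply: cmeasurableM => //; apply: ccontinuous_measurable.
exact: ccontinuous_cexpi_l.
Qed.

Lemma fourier_integrand_decay f K s : quad_decay K f ->
  quad_decay K (fun x => f x * cexpi (s * x)).
Proof. by move=> fK x; rewrite cmodM cmod_cexpi mulr1. Qed.

Lemma cmod_fourier_int f K s : cmeasurable f -> quad_decay K f ->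
  cmod (fourier_int f s) <= K * (2 * quad_mass).
Proof.
move=> mf fK; apply: cmod_cintegral.
- exact: fourier_integrand_measurable.
- exact: fourier_integrand_decay.
Qed.

Lemma continuous_fourier_int f K : cmeasurable f -> quad_decay K f ->
  ccontinuous (fourier_int f).
Proof.
move=> mf fK; apply: (@ccontinuous_cintegral _ _ K).
- by move=> s; exact: fourier_integrand_measurable.
- by move=> s; exact: fourier_integrand_decay.
- move=> x; apply: ccontinuousM; first exact: ccontinuous_cst.
  exact: ccontinuous_cexpi_r.
Qed.

(** Integration by parts: the function [f x * cexpi (s * x)] decays, hence its
    derivative integrates to 0. *)
Lemma fourier_int_derive f f' K K' L s :
  cis_derive f f' -> ccontinuous f' -> quad_decay K f -> quad_decay K' f' ->
  (forall x, `|x| * cmod (f x) <= L) ->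
  fourier_int f' s = - ('i * s%:C) * fourier_int f s.
Proof.
move=> df cf' fK fK' fL.
have cf := cis_derive_continuous df.
have mf := ccontinuous_measurable cf; have mf' := ccontinuous_measurable cf'.
have m1 := fourier_integrand_measurable s mf.
have m2 := fourier_integrand_measurable s mf'.
have d1 := fourier_integrand_decay s fK.
have d2 := fourier_integrand_decay s fK'.
have m3 := cmeasurableZ ('i * s%:C) m1; have d3 := quad_decayZ ('i * s%:C) d1.
suff : fourier_int f' s + 'i * s%:C * fourier_int f s = 0.
  by move/eqP; rewrite addr_eq0 mulNr => /eqP.
rewrite /fourier_int -(cintegralZ _ m1 d1) -(cintegralD m2 m3 d2 d3).
have dfe := cis_deriveM df (@cis_derive_cexpi_l R s).
apply: (@cintegral_derivative_eq0 _ (fun x => f x * cexpi (s * x)) _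
  (K' + cmod ('i * s%:C) * K) L).
- by move=> x; have := dfe x; rewrite mulrCA.
- apply: ccontinuousD.
    by apply: ccontinuousM => //; exact: ccontinuous_cexpi_l.
  apply: ccontinuousM; first exact: ccontinuous_cst.
  by apply: ccontinuousM => //; exact: ccontinuous_cexpi_l.
- exact: quad_decayD.
- by move=> x; rewrite cmodM cmod_cexpi mulr1.
Qed.

Lemma fourier_int_cderiven f s n : schwartz f ->
  fourier_int (cderiven n f) s = (- ('i * s%:C)) ^+ n * fourier_int f s.
Proof.
move=> sf; elim: n => [|n ih]; first by rewrite cderiven0 expr0 mul1r.
have sn := schwartz_cderiven n sf.
rewrite exprS -mulrA -ih cderivenS.
apply: (@fourier_int_derive _ _ (quad_norm n f) (quad_norm n.+1 f)
   (schwartz_seminorm 1 n f)).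
- by apply: csmooth_is_derive; case: sn.
- by apply: csmooth_continuous; case: sn.
- exact: schwartz_quad_decay.
- by rewrite -cderivenS; exact: schwartz_quad_decay.
- by move=> x; have := schwartz_weight_le 1 n x sf; rewrite expr1.
Qed.

Lemma schwartz_measurable f : schwartz f -> cmeasurable f.
Proof.
move=> [sf _]; apply: ccontinuous_measurable; rewrite -(cderiven0 f).
exact: csmooth_continuous.
Qed.

(** The factor [s ^+ n] turns into the n-th derivative of [f], whose Fourier
    integral is bounded. *)
Lemma fourier_int_decay f s n : schwartz f ->
  `|s| ^+ n * cmod (fourier_int f s) <= quad_norm n f * (2 * quad_mass).
Proof.
move=> sf; have := @cmod_fourier_int (cderiven n f) (quad_norm n f) s.
rewrite fourier_int_cderiven// cmodM cmodX cmodN cmodM cmodC.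
rewrite (_ : cmod 'i = 1) ?mul1r; last first.
  by rewrite cmodE /= expr0n expr1n add0r sqrtr1.
apply; last exact: schwartz_quad_decay.
exact: (schwartz_measurable (schwartz_cderiven n sf)).
Qed.

End FourierIntegral.

(** * Fourier inversion at a point near which the function vanishes *)

Section DivisionByX.
Context {R : realType}.
Implicit Types (u : R -> R).

(** Since [u] vanishes near [x0], dividing it by [x - x0] does no harm: the
    quotient, with the convention that 1 / 0 is 0, is as regular as [u]. *)
Lemma continuous_div_vanishing u (x0 d : R) : 0 < d ->
  (forall x, `|x - x0| < d -> u x = 0) -> continuous u ->
  continuous (fun x => u x * (x - x0)^-1).
Proof.
move=> d0 u0 cu x; have [->|xx0] := eqVneq x x0.
  rewrite /continuous_at subrr invr0 mulr0; apply: cvg_near_cst.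
  near=> y; have yd : `|x0 - y| < d by near: y; exact: cvgr_dist_lt.
  by rewrite u0 ?mul0r// distrC.
apply: cvgM; first exact: cu.
apply: cvgV; first by rewrite subr_eq0.
by apply: cvgB; [exact: cvg_id|exact: cvg_cst].
Unshelve. all: by end_near. Qed.

Lemma is_derive_div_vanishing u (u' : R -> R) (x0 d : R) : 0 < d ->
  (forall x, `|x - x0| < d -> u x = 0) ->
  (forall x : R, is_derive x 1 u (u' x)) -> forall x : R,
  is_derive x 1 (fun x => u x * (x - x0)^-1)
    (u' x * (x - x0)^-1 - u x * (x - x0)^-1 * (x - x0)^-1).
Proof.
move=> d0 u0 du x; have [->|xx0] := eqVneq x x0.
  rewrite subrr invr0 !mulr0 subr0.
  have h0 : is_derive x0 1 (fun=> 0 : R) 0 by exact: is_derive_cst.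
  apply: near_eq_is_derive h0.
  near=> y; have yd : `|x0 - y| < d by near: y; exact: cvgr_dist_lt.
  by rewrite u0 ?mul0r// distrC.
have xn0 : x - x0 != 0 by rewrite subr_eq0.
have dV : is_derive x 1 (fun y : R => (y - x0)^-1) (- (x - x0) ^- 2).
  have dl : is_derive x 1 (fun y : R => y - x0) 1.
    by apply: is_derive_eq; rewrite subr0.
  apply: is_derive_eq (@is_deriveV R (fun y => y - x0) x 1 1 xn0 dl) _.
  by rewrite /GRing.scale/= mulr1.
apply: (is_derive_eq (is_deriveM (du x) dV)).
by rewrite /GRing.scale/= expr2 invfM; ring.
Unshelve. all: by end_near. Qed.

Lemma derive_vanishing u (u' : R -> R) (x0 d : R) :
  (forall x, `|x - x0| < d -> u x = 0) ->
  (forall x : R, is_derive x 1 u (u' x)) ->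
  forall x, `|x - x0| < d -> u' x = 0.
Proof.
move=> u0 du x xd; have [_ <-] := du x.
have /near_eq_derive -> : \near x, u x = cst 0 x; last exact: derive_cst.
have e0 : 0 < d - `|x - x0| by rewrite subr_gt0.
near=> y; rewrite u0//.
have : `|x - y| < d - `|x - x0| by near: y; exact: cvgr_dist_lt.
have := ler_distD x y x0; rewrite [`|y - x|]distrC; lra.
Unshelve. all: by end_near. Qed.

End DivisionByX.

Section FourierInversionVanishing.
Context {R : realType}.
Local Notation C := R[i].
Local Notation Re := (@complex.Re R).
Local Notation Im := (@complex.Im R).
Implicit Types (f g : R -> C).

Definition divx (x0 : R) f (x : R) : C := f x * ((x - x0)^-1)%:C.

Lemma divx_cont (x0 d : R) f : 0 < d -> (forall x, `|x - x0| < d -> f x = 0) ->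
  ccontinuous f -> ccontinuous (divx x0 f).
Proof.
move=> d0 f0 [c1 c2]; split.
- rewrite (_ : _ \o _ = fun x => Re (f x) * (x - x0)^-1); last first.
    by apply/funext => x /=; rewrite creM /= mulr0 subr0.
  by apply: continuous_div_vanishing d0 _ c1 => x /f0 /= ->.
- rewrite (_ : _ \o _ = fun x => Im (f x) * (x - x0)^-1); last first.
    by apply/funext => x /=; rewrite cimM /= mulr0 add0r.
  by apply: continuous_div_vanishing d0 _ c2 => x /f0 /= ->.
Qed.

Lemma divx_derive (x0 d : R) f (f' : R -> C) : 0 < d -> (forall x, `|x - x0| < d -> f x = 0) ->
  cis_derive f f' ->
  cis_derive (divx x0 f) (fun x => divx x0 f' x - divx x0 (divx x0 f) x).
Proof.
move=> d0 f0 df x; split.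
- rewrite (_ : _ \o _ = fun x => Re (f x) * (x - x0)^-1); last first.
    by apply/funext => y /=; rewrite creM /= mulr0 subr0.
  rewrite creD creN !creM !cimM /= !mulr0 !subr0.
  apply: (is_derive_div_vanishing (u := Re \o f) (u' := Re \o f') d0).
  + by move=> y /f0 /= ->.
  + by move=> y; have [] := df y.
- rewrite (_ : _ \o _ = fun x => Im (f x) * (x - x0)^-1); last first.
    by apply/funext => y /=; rewrite cimM /= mulr0 add0r.
  rewrite cimD cimN !cimM !creM /= !mulr0 !add0r.
  apply: (is_derive_div_vanishing (u := Im \o f) (u' := Im \o f') d0).
  + by move=> y /f0 /= ->.
  + by move=> y; have [] := df y.
Qed.

Lemma divx_vanish (x0 d : R) f : (forall x, `|x - x0| < d -> f x = 0) ->
  forall x, `|x - x0| < d -> divx x0 f x = 0.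
Proof. by move=> f0 x /f0; rewrite /divx => ->; rewrite mul0r. Qed.

Lemma cmod_divx (x0 d : R) f : 0 < d -> (forall x, `|x - x0| < d -> f x = 0) ->
  forall x, cmod (divx x0 f x) <= d^-1 * cmod (f x).
Proof.
move=> d0 f0 x; have [/f0 fx|dx] := ltP `|x - x0| d.
  by rewrite /divx fx mul0r cmod0 mulr0.
rewrite cmodM mulrC ler_wpM2r ?cmod_ge0// cmodC normfV lef_pV2//.
by rewrite posrE (lt_le_trans d0).
Qed.

Lemma divx_decay (x0 d : R) f (K : R) : 0 < d -> (forall x, `|x - x0| < d -> f x = 0) ->
  quad_decay K f -> quad_decay (d^-1 * K) (divx x0 f).
Proof.
move=> d0 f0 fK x; apply: (le_trans (cmod_divx d0 f0 x)).
by rewrite -mulrA ler_wpM2l ?invr_ge0// ltW.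
Qed.

(** Full Fourier inversion is avoided: writing [f x = (x - x0) * g x], the
    integrand is, up to the factor ['i], the derivative in [s] of
    [cexpi (- x0 * s) * fourier_int g s].  This product decays, as [g] is
    continuously differentiable with an integrable derivative, so its
    derivative integrates to 0. *)
Lemma fourier_inversion_vanishing (x0 d : R) f : 0 < d -> schwartz f ->
  (forall x, `|x - x0| < d -> f x = 0) ->
  cintegral (fun s => cexpi (- x0 * s) * fourier_int f s) = 0.
Proof.
move=> d0 sf f0.
pose g := divx x0 f; pose g' x := divx x0 (cderiven 1 f) x - divx x0 g x.
have df : cis_derive f (cderiven 1 f) by apply: csmooth_is_derive; case: sf.
have cf : ccontinuous f by exact: cis_derive_continuous df.
have cf' : ccontinuous (cderiven 1 f) by apply: csmooth_continuous; case: sf.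
have fK : quad_decay (quad_norm 0 f) f.
  by have := schwartz_quad_decay 0 sf; rewrite cderiven0.
have fK' := schwartz_quad_decay 1 sf.
have f0' x : `|x - x0| < d -> cderiven 1 f x = 0.
  move=> xd; apply: complex_eq => /=.
  - apply: (@derive_vanishing _ (Re \o f) (fun x => Re (cderiven 1 f x)) x0 d) => //.
      by move=> y /f0 /= ->.
    by move=> y; have [] := df y.
  - apply: (@derive_vanishing _ (Im \o f) (fun x => Im (cderiven 1 f x)) x0 d) => //.
      by move=> y /f0 /= ->.
    by move=> y; have [] := df y.
have g0 := divx_vanish f0.
have dg : cis_derive g g' by exact: divx_derive d0 f0 df.
have cg : ccontinuous g by exact: divx_cont d0 f0 cf.
have cg' : ccontinuous g'.
  rewrite /g'; under eq_fun do rewrite -mulN1r.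
  apply: ccontinuousD; first exact: divx_cont d0 f0' cf'.
  by apply: ccontinuousM; [exact: ccontinuous_cst|exact: divx_cont d0 g0 cg].
have gK : quad_decay (d^-1 * quad_norm 0 f) g by exact: divx_decay.
have gK' : quad_decay (d^-1 * quad_norm 1 f + d^-1 * (d^-1 * quad_norm 0 f)) g'.
  apply: quad_decayD; first exact: divx_decay.
  by move=> x; rewrite cmodN; exact: divx_decay.
have gL x : `|x| * cmod (g x) <= d^-1 * schwartz_seminorm 1 0 f.
  apply: (le_trans (ler_wpM2l _ (cmod_divx d0 f0 x))) => //.
  rewrite mulrCA ler_wpM2l ?invr_ge0 ?(ltW d0)//.
  by have := schwartz_weight_le 1 0 x sf; rewrite expr1 cderiven0.
have mf := ccontinuous_measurable cf; have mg := ccontinuous_measurable cg.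
have mg' := ccontinuous_measurable cg'.
pose xg x : C := 'i * x%:C * g x.
have xgE x : xg x = 'i * f x + 'i * x0%:C * g x.
  rewrite /xg /g /divx; have [->|xx0] := eqVneq x x0.
    by rewrite f0 ?subrr ?normr0// mul0r !mulr0 addr0.
  have e : (x - x0)%:C * ((x - x0)^-1)%:C = 1 :> C.
    by rewrite -rmorphM mulfV ?subr_eq0// rmorph1.
  by rewrite -{2}[f x]mulr1 -e rmorphB /=; ring.
have nI : cmod ('i : C) = 1 by rewrite cmodE /= expr0n expr1n add0r sqrtr1.
pose K1 := 1 * quad_norm 0 f + `|x0| * (d^-1 * quad_norm 0 f).
have xgK : quad_decay K1 xg.
  have -> : xg = fun x => 'i * f x + 'i * x0%:C * g x by apply/funext.
  apply: quad_decayD; apply: quad_decayM => // _.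
  - by rewrite nI.
  - by rewrite cmodM nI mul1r cmodC.
have cid : ccontinuous (fun x : R => x%:C).
  by apply: ccontinuous_real => x; exact: cvg_id.
have cxg : ccontinuous xg.
  by do 2?apply: ccontinuousM => //; exact: ccontinuous_cst.
have mxg := ccontinuous_measurable cxg.
have dghat : cis_derive (fourier_int g) (fourier_int xg).
  apply: (@cis_derive_cintegral _ _ _ K1).
  - by move=> s; exact: fourier_integrand_measurable.
  - by move=> s; exists (d^-1 * quad_norm 0 f); exact: fourier_integrand_decay.
  - by move=> s; exact: fourier_integrand_decay.
  - move=> x s; have := cis_deriveM (cis_derive_cst (g x)) (cis_derive_cexpi_r x).
    move=> /(_ s); rewrite (_ : _ + _ = xg x * cexpi (s * x))//.
    by rewrite /xg; ring.
have fxgE s : fourier_int xg s = 'i * fourier_int f s + 'i * x0%:C * fourier_int g s.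
  have m1 := fourier_integrand_measurable s mf.
  have m2 := fourier_integrand_measurable s mg.
  have d1 := fourier_integrand_decay s fK.
  have d2 := fourier_integrand_decay s gK.
  rewrite /fourier_int -(cintegralZ _ m1 d1) -(cintegralZ _ m2 d2).
  rewrite -(cintegralD (cmeasurableZ _ m1) (cmeasurableZ _ m2)
    (quad_decayZ _ d1) (quad_decayZ _ d2)).
  by congr cintegral; apply/funext => x; rewrite xgE; ring.
have dG := cis_deriveM (cis_derive_cexpi_l (- x0)) dghat.
have m0 : cmeasurable (fun s => cexpi (- x0 * s) * fourier_int f s).
  apply: cmeasurableM; apply: ccontinuous_measurable; first exact: ccontinuous_cexpi_l.
  exact: continuous_fourier_int mf fK.
have hK : quad_decay (quad_norm 0 f * (2 * quad_mass) + quad_norm 2 f * (2 * quad_mass))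
    (fun s => cexpi (- x0 * s) * fourier_int f s).
  apply: quad_decay_of_moments => s; rewrite cmodM cmod_cexpi mul1r; apply: lerD.
    by have := fourier_int_decay s 0 sf; rewrite expr0 mul1r.
  exact: fourier_int_decay.
have : 'i * cintegral (fun s => cexpi (- x0 * s) * fourier_int f s) = 0 :> C.
  rewrite -(cintegralZ _ m0 hK).
  apply: (@cintegral_derivative_eq0 _ (fun s => cexpi (- x0 * s) * fourier_int g s) _ _
    (_ * (2 * quad_mass))).
  - move=> s; have := dG s.
    rewrite (_ : _ + _ = 'i * (cexpi (- x0 * s) * fourier_int f s))//.
    by rewrite fxgE rmorphN /=; ring.
  - apply: ccontinuousM; first exact: ccontinuous_cst.
    apply: ccontinuousM; first exact: ccontinuous_cexpi_l.
    exact: continuous_fourier_int mf fK.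
  - exact: quad_decayZ hK.
  - move=> s; rewrite cmodM cmod_cexpi mul1r.
    have := cmod_fourier_int s mg' gK'.
    rewrite (fourier_int_derive s dg cg' gK gK' gL) cmodM cmodN cmodM nI mul1r cmodC.
    exact.
move/eqP; rewrite mulf_eq0 => /orP[/eqP e|/eqP//].
by move: nI; rewrite e cmod0 => /eqP; rewrite eq_sym oner_eq0.
Qed.

End FourierInversionVanishing.

(** * Distributions vanishing outside an interval *)

Section TestFunctions.
Context {R : realType}.
Local Notation C := R[i].
Local Notation Re := (@complex.Re R).
Local Notation Im := (@complex.Im R).
Implicit Types (f g : R -> C) (u : @functional R).

Lemma cderiven_vanishing f (a d : R) n : csmooth f ->
  (forall x, `|x - a| < d -> f x = 0) ->
  forall x, `|x - a| < d -> cderiven n f x = 0.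
Proof.
move=> sf f0; elim: n => [|n ih] x xd; first by rewrite cderiven0 f0.
have df := csmooth_is_derive (csmooth_cderiven n sf).
apply: complex_eq; rewrite cderivenS.
- apply: (@derive_vanishing _ (Re \o cderiven n f)
    (fun x => Re (cderiven 1 (cderiven n f) x)) a d) => //.
    by move=> y /ih e; rewrite /comp e.
  by move=> y; have [] := df y.
- apply: (@derive_vanishing _ (Im \o cderiven n f)
    (fun x => Im (cderiven 1 (cderiven n f) x)) a d) => //.
    by move=> y /ih e; rewrite /comp e.
  by move=> y; have [] := df y.
Qed.

(** A test function supported in the region [N < |x|].  The gap [e] and the
    bound [B] replace the compact support: in this form the condition is easily
    followed through derivatives and dilations. *)
Definition test_outside (N : R) f := csmooth f /\
  exists e B, 0 < e /\ forall x, f x != 0 -> N + e <= `|x| <= B.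

Definition vanishes_outside (N : R) u := forall f, test_outside N f -> u f = 0.

Lemma test_outside_cderiven1 N f : test_outside N f -> test_outside N (cderiven 1 f).
Proof.
move=> [sf [e [B [e0 h]]]]; split; first exact: csmooth_cderiven.
exists e, B; split=> // x f'x; apply/andP; split; rewrite leNgt; apply: contra f'x => xN.
- apply/eqP; apply: (@cderiven_vanishing f x (N + e - `|x|) 1) => //; last first.
    by rewrite subrr normr0 subr_gt0.
  move=> y yx; apply/eqP; apply: contraPT yx => /h /andP[Ny _].
  have := ler_distD x y 0; rewrite !subr0; lra.
- apply/eqP; apply: (@cderiven_vanishing f x (`|x| - B) 1) => //; last first.
    by rewrite subrr normr0 subr_gt0.
  move=> y yx; apply/eqP; apply: contraPT yx => /h /andP[_ yB].
  have := ler_distD y x 0; rewrite !subr0 distrC; lra.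
Qed.

(** The set of moduli of points of the support is compact and does not contain
    [N], so it stays away from [N]; this provides the gap. *)
Lemma test_outside_of_support (N : R) f : csmooth f -> compact (fun_support f) ->
  fun_support f `<=` [set x | N < `|x|] -> test_outside N f.
Proof.
move=> sf cf fN; split=> //.
have cn : compact [set `|x| | x in fun_support f].
  apply: continuous_compact => //; apply: continuous_subspaceT => x.
  exact: norm_continuous.
have [M [_ hM]] := compact_bounded cf.
have cln : closed [set `|x| | x in fun_support f].
  by apply: compact_closed => //; exact: Rhausdorff.
have NN : (~` [set `|x| | x in fun_support f]) N.
  by move=> [x /fN /= Nx]; move: Nx => /[swap] ->; rewrite ltxx.
have /open_nbhs_nbhs/nbhs_ballP[e /= e0 he] :=
  conj (closed_openC cln) NN.
exists e, (M + 1); split=> // x fx.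
have xs : fun_support f x by exact: subset_closure.
apply/andP; split; last by apply: hM => //; rewrite ltrDl.
rewrite leNgt; apply/negP => xNe; have := fN x xs => /= Nx.
apply: (he `|x|); last by exists x.
by rewrite /ball /= distrC gtr0_norm ?subr_gt0// ltrBlDl.
Qed.

Lemma vanishes_outside_compactly_supported N u :
  vanishes_outside N u -> compactly_supported u.
Proof.
move=> uN; apply: (@subclosed_compact _ _ `[- N, N]) => //.
- rewrite /dist_support; apply: open_closedC.
  rewrite (_ : [set x | _] = \bigcup_(U in [set U | open U /\ vanishes_on u U]) U).
    by apply: bigcup_open => U [].
  apply/seteqP; split=> x /= [U]; first by move=> [oU Ux] vU; exists U.
  by move=> [oU vU] Ux; exists U.
- exact: segment_compact.
move=> x /= xS; rewrite in_itv /= -ler_norml leNgt; apply/negP => Nx; apply: xS.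
exists [set x | N < `|x|]; last first.
  by move=> f sf cf fN; apply: uN; exact: test_outside_of_support.
split=> //; rewrite -[X in open X]/((fun x => `|x|) @^-1` [set y | N < y]).
apply: open_comp; last exact: open_gt.
by move=> y _; exact: norm_continuous.
Qed.

Lemma test_outside_schwartz N f : test_outside N f -> schwartz f.
Proof.
move=> [sf [e [B [e0 h]]]]; split=> // a b.
have [c1 c2] := csmooth_continuous b sf.
have bd (w : R -> R) : continuous w ->
    exists M, forall x, x \in `[- `|B|, `|B|] -> `|w x| <= M.
  move=> cw.
  have : compact [set w x | x in `[- `|B|, `|B|]].
    apply: continuous_compact; last exact: segment_compact.
    exact: continuous_subspaceT.
  move/compact_bounded => [M [_ hM]]; exists (M + 1) => x xB.
  by apply: (hM (M + 1)); rewrite ?ltrDl//; exists x.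
have [M1 h1] := bd _ c1; have [M2 h2] := bd _ c2.
exists (`|B| ^+ a * (`|M1| + `|M2|)) => _ [x _ <-]; rewrite /schwartz_weight.
have [xB|Bx] := leP `|x| `|B|.
  have xI : x \in `[- `|B|, `|B|] by rewrite in_itv /= -ler_norml.
  apply: ler_pM; rewrite ?exprn_ge0 ?cmod_ge0//; first by rewrite lerXn2r ?nnegrE.
  apply: le_trans (cmod_ReIm _) _; apply: lerD.
    exact: le_trans (h1 _ xI) (ler_norm _).
  exact: le_trans (h2 _ xI) (ler_norm _).
rewrite (@cderiven_vanishing f x (`|x| - `|B|) b sf) ?cmod0 ?mulr0.
- by rewrite mulr_ge0 ?exprn_ge0 ?addr_ge0.
- move=> y yx; apply/eqP; apply: contraPT yx => /h /andP[_ yB].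
  have := ler_distD y x 0; have := ler_norm B; rewrite !subr0 distrC; lra.
- by rewrite subrr normr0 subr_gt0.
Qed.

End TestFunctions.

(** * Operations on tempered distributions *)

Section SeminormBounds.
Context {R : realType}.
Local Notation C := R[i].
Local Notation Re := (@complex.Re R).
Local Notation Im := (@complex.Im R).
Implicit Types (f g : R -> C) (u : @functional R) (q r : (R -> C) -> R).

Definition seminorm_sum (N : nat) f : R :=
  \sum_(a < N) \sum_(b < N) schwartz_seminorm a b f.

(** The continuity condition of [tempered], separated from linearity and stated
    for any real-valued quantity, so that it can be composed, added and
    scaled. *)
Definition seminorm_bounded q :=
  exists M N, 0 <= M /\ forall f, schwartz f -> q f <= M * seminorm_sum N f.

Lemma ler_sum_widen (F : nat -> R) m n : (m <= n)%N -> (forall i, 0 <= F i) ->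
  \sum_(i < m) F i <= \sum_(i < n) F i.
Proof.
move=> mn F0; rewrite -(subnKC mn) big_split_ord /= lerDl.
by apply: sumr_ge0 => i _.
Qed.

Lemma seminorm_sum_ge0 N f : schwartz f -> 0 <= seminorm_sum N f.
Proof.
by move=> sf; do 2!apply: sumr_ge0 => ? _; exact: schwartz_seminorm_ge0.
Qed.

Lemma seminorm_sum_widen m n f : (m <= n)%N -> schwartz f ->
  seminorm_sum m f <= seminorm_sum n f.
Proof.
move=> mn sf; have S0 a b := schwartz_seminorm_ge0 a b sf.
apply: (@le_trans _ _ (\sum_(a < m) \sum_(b < n) schwartz_seminorm a b f)).
  by apply: ler_sum => a _; exact: (ler_sum_widen (F := fun b => schwartz_seminorm a b f)).
apply: (ler_sum_widen (F := fun a => \sum_(b < n) schwartz_seminorm a b f)) => // a.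
by apply: sumr_ge0.
Qed.

Lemma seminorm_bounded_le q r : (forall f, schwartz f -> q f <= r f) ->
  seminorm_bounded r -> seminorm_bounded q.
Proof.
move=> qr [M [N [M0 h]]]; exists M, N; split=> // f sf.
exact: le_trans (qr f sf) (h f sf).
Qed.

Lemma seminorm_boundedS a b : seminorm_bounded (schwartz_seminorm a b).
Proof.
exists 1, (a + b).+1; split=> // f sf; rewrite mul1r.
have S0 a b := schwartz_seminorm_ge0 a b sf.
have ha : (a < (a + b).+1)%N by rewrite ltnS leq_addr.
have hb : (b < (a + b).+1)%N by rewrite ltnS leq_addl.
rewrite /seminorm_sum (bigD1 (Ordinal ha)) //= (bigD1 (Ordinal hb)) //= -addrA lerDl.
by rewrite addr_ge0 ?sumr_ge0// => i _; rewrite sumr_ge0.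
Qed.

Lemma seminorm_boundedD q r : seminorm_bounded q -> seminorm_bounded r ->
  seminorm_bounded (fun f => q f + r f).
Proof.
move=> [M1 [N1 [p1 h1]]] [M2 [N2 [p2 h2]]]; exists (M1 + M2), (maxn N1 N2).
split; first exact: addr_ge0.
move=> f sf; rewrite mulrDl; apply: lerD.
- apply: le_trans (h1 f sf) _; rewrite ler_wpM2l// seminorm_sum_widen//.
  exact: leq_maxl.
- apply: le_trans (h2 f sf) _; rewrite ler_wpM2l// seminorm_sum_widen//.
  exact: leq_maxr.
Qed.

Lemma seminorm_boundedZ q (c : R) : 0 <= c -> seminorm_bounded q ->
  seminorm_bounded (fun f => c * q f).
Proof.
move=> c0 [M [N [M0 h]]]; exists (c * M), N; split; first exact: mulr_ge0.
by move=> f sf; rewrite -mulrA ler_wpM2l// h.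
Qed.

Lemma seminorm_bounded_sum (I : Type) (s : seq I) (q : I -> (R -> C) -> R) :
  (forall i, seminorm_bounded (q i)) ->
  seminorm_bounded (fun f => \sum_(i <- s) q i f).
Proof.
move=> hq; elim: s => [|i s ih].
  exists 0, 0%N; split=> // f sf.
  by rewrite big_nil mul0r.
apply: seminorm_bounded_le (seminorm_boundedD (hq i) ih) => f _.
by rewrite big_cons.
Qed.

(** A map on Schwartz functions is continuous as soon as it is so for each single
    seminorm. *)
Lemma seminorm_bounded_comp q (T : (R -> C) -> (R -> C)) :
  (forall f, schwartz f -> schwartz (T f)) ->
  (forall a b, seminorm_bounded (fun f => schwartz_seminorm a b (T f))) ->
  seminorm_bounded q -> seminorm_bounded (fun f => q (T f)).
Proof.
move=> Ts TS [M [N [M0 h]]].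
apply: (@seminorm_bounded_le _ (fun f => M * seminorm_sum N (T f))).
  by move=> f sf; apply: h; exact: Ts.
apply: seminorm_boundedZ => //; rewrite /seminorm_sum.
apply: (@seminorm_bounded_sum _ _
  (fun (a : 'I_N) f => \sum_(b < N) schwartz_seminorm a b (T f))) => a.
by apply: (@seminorm_bounded_sum _ _ (fun (b : 'I_N) f => schwartz_seminorm a b (T f))).
Qed.

Lemma temperedP u :
  (forall (c : C) f g, schwartz f -> schwartz g ->
    u (fun x => c * f x + g x) = c * u f + u g) ->
  seminorm_bounded (fun f => cmod (u f)) -> tempered u.
Proof. by move=> hl [M [N [M0 h]]]; split=> //; exists M, N. Qed.

Lemma tempered_bounded u : tempered u -> seminorm_bounded (fun f => cmod (u f)).
Proof.
move=> [_ [M [N h]]]; exists `|M|, N; split=> // f sf.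
apply: le_trans (h f sf) _; rewrite ler_wpM2r ?ler_norm//.
exact: seminorm_sum_ge0.
Qed.

Lemma tempered_lin_comb (I : Type) (s : seq I) (c : I -> C) (u : I -> @functional R) :
  (forall i, tempered (u i)) -> tempered (fun f => \sum_(i <- s) c i * u i f).
Proof.
move=> tu; apply: temperedP.
  move=> k f g sf sg; rewrite mulr_sumr -big_split /=; apply: eq_bigr => i _.
  by have [-> // _] := tu i; rewrite mulrDr mulrCA.
apply: (@seminorm_bounded_le _ (fun f => \sum_(i <- s) cmod (c i) * cmod (u i f))).
  move=> f _; apply: le_trans (cmod_sum _ _ _) _.
  by apply: ler_sum => i _; rewrite cmodM.
apply: (@seminorm_bounded_sum _ _ (fun i f => cmod (c i) * cmod (u i f))) => i.
by apply: seminorm_boundedZ; [exact: cmod_ge0|exact: tempered_bounded].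
Qed.

Lemma cderiven1_linear (c : C) f g : csmooth f -> csmooth g ->
  cderiven 1 (fun x => c * f x + g x) = fun x => c * cderiven 1 f x + cderiven 1 g x.
Proof.
move=> sf sg; apply/funext => x.
have := cis_deriveD (cis_deriveM (cis_derive_cst c) (csmooth_is_derive sf))
  (csmooth_is_derive sg).
move=> /(_ x); rewrite mul0r add0r => -[[_ e1] [_ e2]].
by apply: complex_eq; rewrite /= derive1E.
Qed.

Lemma tempered_dist_derive u : tempered u -> tempered (dist_derive u).
Proof.
move=> tu; apply: temperedP.
  move=> c f g sf sg; rewrite /dist_derive cderiven1_linear; [|by case: sf|by case: sg].
  have [hl _] := tu; rewrite hl; [|exact: schwartz_cderiven|exact: schwartz_cderiven].
  by rewrite opprD mulrN.
apply: (@seminorm_bounded_le _ (fun f => cmod (u (cderiven 1 f)))).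
  by move=> f _; rewrite cmodN.
apply: (seminorm_bounded_comp (q := fun f => cmod (u f))); last exact: tempered_bounded.
  by move=> f; exact: schwartz_cderiven.
move=> a b; apply: seminorm_bounded_le (seminorm_boundedS a (b + 1)) => f _.
by rewrite schwartz_seminorm_cderiven.
Qed.

Lemma vanishes_outside_dist_derive N u :
  vanishes_outside N u -> vanishes_outside N (dist_derive u).
Proof.
by move=> uN f tf; rewrite /dist_derive uN ?oppr0//; exact: test_outside_cderiven1.
Qed.

Definition dilate (k : int) f (x : R) : C := f ((x + k%:~R) / 2).

Lemma derive1n_dilate (k : R) (w : R -> R) n :
  (forall n x, derivable (derive1n n w) x 1) ->
  derive1n n (fun x => w ((x + k) / 2)) =
  (fun x => 2 ^- n * derive1n n w ((x + k) / 2)) /\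
  forall x, derivable (derive1n n (fun x => w ((x + k) / 2))) x 1.
Proof.
move=> dw.
have step m (x : R) : is_derive x 1 (fun x => 2 ^- m * derive1n m w ((x + k) / 2))
    (2 ^- m.+1 * derive1n m.+1 w ((x + k) / 2)).
  have da : is_derive x 1 (fun x : R => (x + k) / 2) 2^-1.
    by apply: is_derive_eq; rewrite /GRing.scale/=; lra.
  have dm : is_derive ((x + k) / 2) 1 (derive1n m w) (derive1n m.+1 w ((x + k) / 2)).
    by apply: DeriveDef => //; rewrite -derive1E.
  have := is_deriveZ (2 ^- m) (@is_derive1_comp R (derive1n m w) (fun x => (x + k) / 2) x _ _ dm da).
  by move=> h; apply: (is_derive_eq h); rewrite /GRing.scale/= exprS invfM; ring.
elim: n => [|n [ih1 ih2]].
  split; first by apply/funext => x; rewrite expr0 invr1 mul1r.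
  move=> x; have [] := step 0%N x.
  by rewrite (_ : (fun x => _) = (fun x => w ((x + k) / 2)))//; apply/funext => y; rewrite expr0 invr1 mul1r.
have e : derive1n n.+1 (fun x => w ((x + k) / 2)) =
  (fun x => 2 ^- n.+1 * derive1n n.+1 w ((x + k) / 2)).
  apply/funext => x; rewrite derive1nS ih1 derive1E.
  by have [_ ->] := step n x.
by split=> // x; rewrite e; have [] := step n.+1 x.
Qed.

Lemma cderiven_dilate k f n : csmooth f ->
  cderiven n (dilate k f) = fun x => (2 ^- n)%:C * dilate k (cderiven n f) x.
Proof.
move=> sf; apply/funext => x.
have [e1 _] := @derive1n_dilate k%:~R (Re \o f) n (fun n x => (sf n x).1).
have [e2 _] := @derive1n_dilate k%:~R (Im \o f) n (fun n x => (sf n x).2).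
apply: complex_eq; rewrite ?creM ?cimM /= ?mul0r ?subr0 ?addr0.
  by rewrite -[X in derive1n n X]/(fun x => (Re \o f) ((x + k%:~R) / 2)) e1.
by rewrite -[X in derive1n n X]/(fun x => (Im \o f) ((x + k%:~R) / 2)) e2.
Qed.

Lemma csmooth_dilate k f : csmooth f -> csmooth (dilate k f).
Proof.
move=> sf n x; split.
  by have [_ ] := @derive1n_dilate k%:~R (Re \o f) n (fun n x => (sf n x).1).
by have [_ ] := @derive1n_dilate k%:~R (Im \o f) n (fun n x => (sf n x).2).
Qed.

(** Substitute [y = (x + k) / 2], so [|x| <= 2 * |y| + |k|], and bound this sum by
    twice the larger term. *)
Lemma schwartz_weight_dilate k f a b x : schwartz f ->
  schwartz_weight a b (dilate k f) x <=
  4 ^+ a * schwartz_seminorm a b f + (2 * `|k%:~R|) ^+ a * schwartz_seminorm 0 b f.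
Proof.
move=> sf; rewrite /schwartz_weight cderiven_dilate ?cmodM ?cmodC; last by case: sf.
set y := (x + k%:~R) / 2.
have h1 := schwartz_weight_le a b y sf.
have := schwartz_weight_le 0 b y sf; rewrite expr0 mul1r => h2.
have xa : `|x| ^+ a <= 4 ^+ a * `|y| ^+ a + (2 * `|k%:~R|) ^+ a.
  have xy : `|x| <= 2 * `|y| + `|k%:~R|.
    have -> : x = 2 * y - k%:~R by rewrite /y mulrCA divff ?mulr1 ?addrK// pnatr_eq0.
    by apply: le_trans (ler_normB _ _) _; rewrite normrM [`|2|]ger0_norm.
  have [ky|yk] := leP `|k%:~R| (2 * `|y|).
    apply: ler_wpDr; first by rewrite exprn_ge0// mulr_ge0.
    rewrite -exprMn lerXn2r ?nnegrE ?mulr_ge0//; lra.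
  apply: ler_wpDl; first by rewrite mulr_ge0 ?exprn_ge0.
  by rewrite lerXn2r ?nnegrE ?mulr_ge0//; lra.
have b1 : `|2 ^- b : R| * cmod (dilate k (cderiven b f) x) <= cmod (cderiven b f y).
  rewrite ler_piMl ?cmod_ge0// ger0_norm ?invr_ge0 ?exprn_ge0// invf_le1 ?exprn_gt0//.
  by rewrite exprn_ege1// ler1n.
apply: (@le_trans _ _ ((4 ^+ a * `|y| ^+ a + (2 * `|k%:~R|) ^+ a) * cmod (cderiven b f y))).
  by apply: ler_pM; rewrite ?exprn_ge0 ?mulr_ge0 ?cmod_ge0.
rewrite mulrDl -mulrA; apply: lerD; apply: ler_wpM2l => //.
Qed.

Lemma schwartz_dilate k f : schwartz f -> schwartz (dilate k f).
Proof.
move=> sf; split; first by apply: csmooth_dilate; case: sf.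
by move=> a b; eexists => _ [x _ <-]; exact: schwartz_weight_dilate.
Qed.

Lemma tempered_dist_dilate k u : tempered u -> tempered (dist_dilate k u).
Proof.
move=> tu; apply: temperedP.
  move=> c f g sf sg; rewrite /dist_dilate -[X in u X]/(fun x => c * dilate k f x + dilate k g x).
  have [hl _] := tu; rewrite hl; [|exact: schwartz_dilate|exact: schwartz_dilate].
  by rewrite mulrDr mulrCA.
apply: (@seminorm_bounded_le _ (fun f => cmod (2^-1 : C) * cmod (u (dilate k f)))).
  by move=> f _; rewrite cmodM.
apply: seminorm_boundedZ; first exact: cmod_ge0.
apply: (seminorm_bounded_comp (q := fun f => cmod (u f))); last exact: tempered_bounded.
  exact: schwartz_dilate.
move=> a b; apply: (@seminorm_bounded_le _ (fun f => 4 ^+ a * schwartz_seminorm a b f +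
   (2 * `|k%:~R|) ^+ a * schwartz_seminorm 0 b f)).
  by move=> f sf; apply: schwartz_seminorm_le => x; exact: schwartz_weight_dilate.
apply: seminorm_boundedD; apply: seminorm_boundedZ; try exact: seminorm_boundedS.
  by rewrite exprn_ge0.
by rewrite exprn_ge0// mulr_ge0.
Qed.

(** The dilate lives on the interval of centre [k / 2] and radius [N / 2], which
    is contained in the interval of centre 0 and radius [N + |k|]. *)
Lemma vanishes_outside_dist_dilate N k u : 0 <= N -> vanishes_outside N u ->
  vanishes_outside (N + `|k%:~R|) (dist_dilate k u).
Proof.
move=> N0 uN f [sf [e [B [e0 h]]]]; rewrite /dist_dilate -[X in u X]/(dilate k f) uN ?mulr0//.
split; first exact: csmooth_dilate.
exists e, (2 * B + `|k%:~R|); split=> // x /h.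
rewrite normrM [`|2^-1|]ger0_norm// => /andP[h1 h2].
have h3 := ler_normD x k%:~R; have := ler_normB (x + k%:~R) k%:~R; rewrite addrK => h4.
have k0 := normr_ge0 (k%:~R : R).
by apply/andP; split; lra.
Qed.

End SeminormBounds.

(** * Inverse Fourier transforms of functions of polynomial growth *)

Section InverseFourierTransforms.
Context {R : realType}.
Local Notation C := R[i].
Local Notation Re := (@complex.Re R).
Local Notation Im := (@complex.Im R).
Implicit Types (f g F : R -> C).

Let ft_const : R := (Num.sqrt (2 * pi))^-1.

Let ft_const_ge0 : 0 <= ft_const.
Proof. by rewrite invr_ge0 sqrtr_ge0. Qed.

(** The combination of Schwartz seminorms of [f] that controls the product of
    the inverse Fourier transform of [f] with a function of growth [|s| ^+ L]. *)
Definition growth_norm (L : nat) f : R :=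
  ft_const * (2 * quad_mass) *
    (quad_norm 0 f + quad_norm 2 f + quad_norm L f + quad_norm L.+2 f).

Definition poly_growth (K : R) (L : nat) F :=
  forall s, cmod (F s) <= K * (1 + `|s| ^+ L).

Lemma fun_ifourier_measurable f : schwartz f -> cmeasurable (fun_ifourier f).
Proof.
move=> sf; apply: cmeasurableZ; apply: ccontinuous_measurable.
apply: (@continuous_fourier_int _ _ (quad_norm 0 f)); first exact: schwartz_measurable.
by have := schwartz_quad_decay 0 sf; rewrite cderiven0.
Qed.

(** Expand [(1 + |s| ^+ L) * (1 + |s| ^+ 2)] and bound each of the four terms by
    the decay of the Fourier integral. *)
Lemma ifourier_growth_decay (K : R) L F f : 0 <= K -> poly_growth K L F -> schwartz f ->
  quad_decay (K * growth_norm L f) (fun s => F s * fun_ifourier f s).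
Proof.
move=> K0 FK sf; apply: quad_decay_of_moments => s.
rewrite cmodM fun_ifourierE cmodM cmodC ger0_norm ?ft_const_ge0// -/ft_const.
set v := cmod (fourier_int f s); have v0 : 0 <= v by exact: cmod_ge0.
apply: (@le_trans _ _ ((K * (1 + `|s| ^+ L)) * (ft_const * v) * (1 + `|s| ^+ 2))).
  rewrite (_ : _ + _ = cmod (F s) * (ft_const * v) * (1 + `|s| ^+ 2)); last by ring.
  have w0 : 0 <= ft_const * v * (1 + `|s| ^+ 2).
    by rewrite !mulr_ge0// addr_ge0// exprn_ge0.
  by rewrite -!(mulrA _ (ft_const * v)) ler_wpM2r.
have := fourier_int_decay s 0 sf; rewrite expr0 mul1r => h0.
have h2 := fourier_int_decay s 2 sf; have h3 := fourier_int_decay s L sf.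
have sL : `|s| ^+ L * `|s| ^+ 2 = `|s| ^+ L.+2 by rewrite -exprD addnC.
have := fourier_int_decay s L.+2 sf; rewrite -sL => h4.
rewrite /growth_norm (_ : _ * _ * (1 + _) = K * (ft_const *
  (v + `|s| ^+ 2 * v + `|s| ^+ L * v + `|s| ^+ L * `|s| ^+ 2 * v))); last by ring.
rewrite ler_wpM2l// -[X in _ <= X]mulrA ler_wpM2l//.
move: h0 h2 h3 h4; rewrite -/v.
move: (quad_norm 0 f) (quad_norm 2 f) (quad_norm L f) (quad_norm L.+2 f) (2 * quad_mass).
move=> q0 q2 qL qL2 Q h0 h2 h3 h4; rewrite [X in _ <= X]mulrC !mulrDl.
exact: (lerD (lerD (lerD h0 h2) h3) h4).
Qed.

Lemma seminorm_bounded_growth_norm L : seminorm_bounded (@growth_norm L).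
Proof.
apply: seminorm_boundedZ.
  by rewrite mulr_ge0 ?ft_const_ge0// mulr_ge0// quad_mass_ge0.
have Q n : @seminorm_bounded R (quad_norm n).
  by apply: seminorm_boundedD; exact: seminorm_boundedS.
exact: (seminorm_boundedD (seminorm_boundedD (seminorm_boundedD (Q 0%N) (Q 2%N)) (Q L)) (Q L.+2)).
Qed.

Lemma fun_ifourier_linear (c : C) f g s : schwartz f -> schwartz g ->
  fun_ifourier (fun x => c * f x + g x) s = c * fun_ifourier f s + fun_ifourier g s.
Proof.
move=> sf sg; rewrite !fun_ifourierE mulrCA -mulrDr; congr (_ * _).
have m1 := fourier_integrand_measurable s (schwartz_measurable sf).
have m2 := fourier_integrand_measurable s (schwartz_measurable sg).
have := schwartz_quad_decay 0 sf; rewrite cderiven0 => /(fourier_integrand_decay s) d1.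
have := schwartz_quad_decay 0 sg; rewrite cderiven0 => /(fourier_integrand_decay s) d2.
rewrite /fourier_int -(cintegralZ _ m1 d1).
rewrite -(cintegralD (cmeasurableZ c m1) m2 (quad_decayZ c d1) d2).
by congr cintegral; apply/funext => x; rewrite mulrDl mulrA.
Qed.

Lemma tempered_ifourier (K : R) L F : 0 <= K -> cmeasurable F -> poly_growth K L F ->
  tempered (dist_ifourier (regular_dist F)).
Proof.
move=> K0 mF FK; rewrite /dist_ifourier /regular_dist.
have m h : schwartz h -> cmeasurable (fun s => F s * fun_ifourier h s).
  by move=> sh; apply: cmeasurableM => //; exact: fun_ifourier_measurable.
have d h : schwartz h -> quad_decay (K * growth_norm L h) (fun s => F s * fun_ifourier h s).
  by move=> sh; exact: ifourier_growth_decay.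
apply: temperedP.
  move=> c f g sf sg.
  rewrite -(cintegralZ _ (m f sf) (d f sf)).
  rewrite -(cintegralD (cmeasurableZ c (m f sf)) (m g sg) (quad_decayZ c (d f sf)) (d g sg)).
  by congr cintegral; apply/funext => s; rewrite fun_ifourier_linear// mulrDr mulrCA.
apply: (@seminorm_bounded_le _ _ (fun f => (K * (2 * quad_mass)) * growth_norm L f)).
  by move=> f sf; rewrite mulrAC; apply: cmod_cintegral; [exact: m|exact: d].
apply: seminorm_boundedZ; last exact: seminorm_bounded_growth_norm.
by rewrite !mulr_ge0// quad_mass_ge0.
Qed.

(** Trigonometric polynomials with frequencies in [-N, N]; their inverse
    Fourier transforms are the finite combinations of point masses in that
    interval. *)
Inductive trig_poly : R -> (R -> C) -> Prop :=
| trig_poly_exp N c t : `|t| <= N -> trig_poly N (fun s => c * cexpi (t * s))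
| trig_poly_add N F G : trig_poly N F -> trig_poly N G ->
    trig_poly N (fun s => F s + G s).

Lemma trig_poly_cst N c : 0 <= N -> trig_poly N (fun=> c).
Proof.
move=> N0; have -> : (fun=> c) = (fun s : R => c * cexpi (0 * s)).
  by apply/funext => s; rewrite mul0r cexpi0 mulr1.
by apply: trig_poly_exp; rewrite normr0.
Qed.

Lemma trig_poly_sum (I : Type) (r : seq I) (F : I -> R -> C) N : 0 <= N ->
  (forall i, trig_poly N (F i)) -> trig_poly N (fun s => \sum_(i <- r) F i s).
Proof.
move=> N0 hF; elim: r => [|i r ih].
  by under eq_fun do rewrite big_nil; exact: trig_poly_cst.
by under eq_fun do rewrite big_cons; exact: trig_poly_add.
Qed.

Lemma trig_polyM M N F G : trig_poly M F -> trig_poly N G ->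
  trig_poly (M + N) (fun s => F s * G s).
Proof.
move=> hF hG; elim: hF => {M F}[M c t tM|M F1 F2 _ h1 _ h2]; last first.
  by under eq_fun do rewrite mulrDl; exact: trig_poly_add.
elim: hG => {N G}[N d r rN|N G1 G2 _ h1 _ h2]; last first.
  by under eq_fun do rewrite mulrDr; exact: trig_poly_add.
have -> : (fun s => c * cexpi (t * s) * (d * cexpi (r * s))) =
          (fun s => (c * d) * cexpi ((t + r) * s)).
  by apply/funext => s; rewrite mulrDl cexpiD; ring.
by apply: trig_poly_exp; apply: le_trans (ler_normD _ _) _; exact: lerD.
Qed.

Lemma trig_poly_half N F : trig_poly N F -> trig_poly (N / 2) (fun s => F (s / 2)).
Proof.
elim=> {N F}[N c t tN|N F G _ h1 _ h2]; last exact: trig_poly_add.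
have -> : (fun s => c * cexpi (t * (s / 2))) = (fun s => c * cexpi (t / 2 * s)).
  by apply/funext => s; rewrite mulrA mulrAC.
by apply: trig_poly_exp; rewrite normrM [`|2^-1|]ger0_norm// ler_wpM2r.
Qed.

Lemma trig_poly_continuous N F : trig_poly N F -> ccontinuous F.
Proof.
elim=> {N F}[N c t _|N F G _ h1 _ h2]; last exact: ccontinuousD.
by apply: ccontinuousM; [exact: ccontinuous_cst|exact: ccontinuous_cexpi_l].
Qed.

Lemma trig_poly_bounded N F : trig_poly N F ->
  exists2 K, 0 <= K & forall s, cmod (F s) <= K.
Proof.
elim=> {N F}[N c t _|N F G _ [K K0 h1] _ [L L0 h2]].
  exists (cmod c); first exact: cmod_ge0.
  by move=> s; rewrite cmodM cmod_cexpi mulr1.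
exists (K + L); first exact: addr_ge0.
by move=> s; apply: le_trans (cmodD _ _) _; exact: lerD.
Qed.

(** By linearity only one exponential matters, and there the integral is, up to a
    constant, the value of [f] at a point of [-N, N], near which [f] vanishes. *)
Lemma trig_poly_integral_eq0 N F f : trig_poly N F -> test_outside N f ->
  cintegral (fun s => F s * fun_ifourier f s) = 0.
Proof.
move=> tF tf; have sf := test_outside_schwartz tf.
have m h : ccontinuous h -> cmeasurable (fun s => h s * fun_ifourier f s).
  move=> ch; apply: cmeasurableM; first exact: ccontinuous_measurable.
  exact: fun_ifourier_measurable.
have d M h : trig_poly M h -> exists K, quad_decay K (fun s => h s * fun_ifourier f s).
  move=> /trig_poly_bounded[K K0 hK]; eexists.
  apply: (@ifourier_growth_decay K 0 _ _ K0) => // s.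
  apply: le_trans (hK s) _; rewrite ler_peMr// expr0; lra.
have [_ [e [B [e0 fB]]]] := tf; move: e0 fB => e0 fB.
elim: tF fB => {N F tf}[N c t tN|N F G tF h1 tG h2] fB; last first.
  have [K hK] := d _ _ tF; have [L hL] := d _ _ tG.
  under eq_fun do rewrite mulrDl.
  rewrite (cintegralD (m _ (trig_poly_continuous tF)) (m _ (trig_poly_continuous tG)) hK hL).
  by rewrite h1// h2// addr0.
have fv x : `|x - - t| < e -> f x = 0.
  move=> xt; apply/eqP; apply: contraPT xt => /fB /andP[Nx _].
  have := ler_normB (x - - t) t; rewrite opprK addrK; lra.
have := fourier_inversion_vanishing e0 sf fv; rewrite opprK => h0.
have mf := schwartz_measurable sf.
have := schwartz_quad_decay 0 sf; rewrite cderiven0 => fK.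
have mm : cmeasurable (fun s => cexpi (t * s) * fourier_int f s).
  apply: cmeasurableM; apply: ccontinuous_measurable; first exact: ccontinuous_cexpi_l.
  exact: continuous_fourier_int mf fK.
have dd : quad_decay (quad_norm 0 f * (2 * quad_mass) + quad_norm 2 f * (2 * quad_mass))
    (fun s => cexpi (t * s) * fourier_int f s).
  apply: quad_decay_of_moments => s; rewrite cmodM cmod_cexpi mul1r; apply: lerD.
    by have := fourier_int_decay s 0 sf; rewrite expr0 mul1r.
  exact: fourier_int_decay.
have := cintegralZ (c * ft_const%:C) mm dd; rewrite h0 mulr0 => <-.
congr cintegral; apply/funext => s; rewrite fun_ifourierE -/ft_const; ring.
Qed.

(** An elementary substitute for the Paley-Wiener theorem: the vanishing of the
    approximants on a test function passes to the limit by dominated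
    convergence, the majorant coming from the uniform polynomial growth. *)
Lemma vanishes_outside_ifourier N (K : R) L (F_ : nat -> R -> C) F : 0 <= K ->
  (forall n, trig_poly N (F_ n)) -> (forall n, poly_growth K L (F_ n)) ->
  (forall s, Re (F_ n s) @[n --> \oo] --> Re (F s)) ->
  (forall s, Im (F_ n s) @[n --> \oo] --> Im (F s)) ->
  vanishes_outside N (dist_ifourier (regular_dist F)).
Proof.
move=> K0 tF FK FRe FIm f tf; have sf := test_outside_schwartz tf.
rewrite /dist_ifourier /regular_dist.
have int0 n := trig_poly_integral_eq0 (tF n) tf.
have [||||r i] := @cintegral_cvg _ (fun n s => F_ n s * fun_ifourier f s)
  (fun s => F s * fun_ifourier f s) (K * growth_norm L f).
- move=> n; apply: cmeasurableM; last exact: fun_ifourier_measurable.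
  exact/ccontinuous_measurable/trig_poly_continuous.
- by move=> n; exact: ifourier_growth_decay.
- move=> s; rewrite creM; under eq_fun do rewrite creM.
  by apply: cvgB; (apply: cvgM; last exact: cvg_cst).
- move=> s; rewrite cimM; under eq_fun do rewrite cimM.
  by apply: cvgD; (apply: cvgM; last exact: cvg_cst).
move: r i; under eq_fun do rewrite int0; move=> r.
under eq_fun do rewrite int0; move=> i.
by apply: complex_eq; [exact: (cvg_unique _ r (cvg_cst _))|exact: (cvg_unique _ i (cvg_cst _))].
Qed.

End InverseFourierTransforms.

(** * Infinite products of matrices of trigonometric polynomials *)

Section TrigPolyLipschitz.
Context {R : realType}.
Local Notation C := R[i].

Lemma derivative_le1_lipschitz (u du : R -> R) : (forall x : R, is_derive x 1 u (du x)) ->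
  (forall x, `|du x| <= 1) -> forall x y, `|u x - u y| <= `|x - y|.
Proof.
move=> hd h1.
have cu : continuous u.
  by move=> x; apply/differentiable_continuous/derivable1_diffP; have [] := hd x.
suff main x y : y <= x -> `|u x - u y| <= `|x - y|.
  move=> x y; have [|/ltW] := leP y x; first exact: main.
  by move=> /main; rewrite distrC [`|y - x|]distrC.
move=> yx; have [z _ ->] := MVT_segment yx (fun z _ => hd z) (continuous_subspaceT cu).
by rewrite normrM ler_piMl.
Qed.

(** The constant 2 is not sharp; it comes from bounding the real and the imaginary
    part separately. *)
Lemma cmod_cexpiB1 (t : R) : cmod (cexpi t - 1) <= 2 * `|t|.
Proof.
apply: le_trans (cmod_ReIm _) _; rewrite creD cimD creN cimN /= subr0.
have := derivative_le1_lipschitz (fun x : R => is_derive_cos x)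
  (fun x => _ : `|- sin x| <= 1) t 0; rewrite cos0 subr0 => h1.
have := derivative_le1_lipschitz (fun x : R => is_derive_sin x)
  (fun x => _ : `|cos x| <= 1) t 0; rewrite sin0 !subr0 => h2.
rewrite mulr_natl mulr2n; apply: lerD; [apply: h1|apply: h2] => x.
  by rewrite normrN sin_max.
exact: cos_max.
Qed.

Lemma trig_poly_lipschitz N (F : R -> C) : trig_poly N F ->
  exists2 K, 0 <= K & forall s, cmod (F s - F 0) <= K * `|s|.
Proof.
elim=> {N F}[N c t _|N F G _ [K K0 h1] _ [L L0 h2]].
  exists (cmod c * (2 * `|t|)); first by rewrite !mulr_ge0// cmod_ge0.
  move=> s; rewrite mulr0 cexpi0 -mulrBr cmodM -!mulrA ler_wpM2l ?cmod_ge0//.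
  by rewrite -normrM cmod_cexpiB1.
exists (K + L); first exact: addr_ge0.
move=> s; rewrite opprD addrACA mulrDl; apply: le_trans (cmodD _ _) _; exact: lerD.
Qed.

End TrigPolyLipschitz.

Section ComplexSequences.
Context {R : realType}.
Local Notation C := R[i].
Local Notation Re := (@complex.Re R).
Local Notation Im := (@complex.Im R).
Implicit Types (u : nat -> C).

Definition ccvgn u := cvgn (Re \o u : R^nat) /\ cvgn (Im \o u : R^nat).

Lemma ccvgn_cst (c : C) : ccvgn (fun=> c).
Proof. by split; exact: is_cvg_cst. Qed.

Lemma ccvgnD u w : ccvgn u -> ccvgn w -> ccvgn (fun n => u n + w n).
Proof.
move=> [u1 u2] [w1 w2]; split.
- rewrite (_ : Re \o _ = (Re \o u) \+ (Re \o w)); last by apply/funext => y /=; rewrite creD.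
  exact: is_cvgD.
- rewrite (_ : Im \o _ = (Im \o u) \+ (Im \o w)); last by apply/funext => y /=; rewrite cimD.
  exact: is_cvgD.
Qed.

Lemma ccvgnZ (c : C) u : ccvgn u -> ccvgn (fun n => c * u n).
Proof.
move=> [u1 u2]; split.
- rewrite (_ : Re \o _ = (fun n => Re c * Re (u n) - Im c * Im (u n))); last first.
    by apply/funext => y /=; rewrite creM.
  by apply: is_cvgB; (apply: is_cvgM; first exact: is_cvg_cst).
- rewrite (_ : Im \o _ = (fun n => Re c * Im (u n) + Im c * Re (u n))); last first.
    by apply/funext => y /=; rewrite cimM.
  by apply: is_cvgD; (apply: is_cvgM; first exact: is_cvg_cst).
Qed.

Lemma ccvgn_sum (I : Type) (r : seq I) (u : I -> nat -> C) :
  (forall i, ccvgn (u i)) -> ccvgn (fun n => \sum_(i <- r) u i n).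
Proof.
move=> hu; elim: r => [|i r ih].
  by under eq_fun do rewrite big_nil; exact: ccvgn_cst.
by under eq_fun do rewrite big_cons; exact: ccvgnD.
Qed.

Lemma ccvgn_shiftS u : ccvgn (fun n => u n.+1) -> ccvgn u.
Proof.
move=> [/cvg_ex[l hl] /cvg_ex[k hk]]; split; apply/cvg_ex.
- by exists l; rewrite -cvg_shiftS.
- by exists k; rewrite -cvg_shiftS.
Qed.

Lemma cvgn_geometric_increments (w : R^nat) (D q : R) : 0 <= D -> 0 <= q -> q < 1 ->
  (forall n, `|w n.+1 - w n| <= D * q ^+ n) -> cvgn w.
Proof.
move=> D0 q0 q1 hw.
have : cvgn (series (telescope w)).
  apply: normed_cvg; apply: (@series_le_cvg _ _ (geometric D q)) => //=.
  - by move=> n; rewrite mulr_ge0 ?exprn_ge0.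
  - by apply: is_cvg_geometric_series; rewrite ger0_norm.
rewrite telescopeK => h.
have -> : w = (fun n => w 0%N + (w n - w 0%N)) by apply/funext => n; rewrite addrC subrK.
by apply: is_cvgD => //; exact: is_cvg_cst.
Qed.

Lemma ccvgn_geometric_increments u (D q : R) : 0 <= D -> 0 <= q -> q < 1 ->
  (forall n, cmod (u n.+1 - u n) <= D * q ^+ n) -> ccvgn u.
Proof.
move=> D0 q0 q1 hu; split; apply: (@cvgn_geometric_increments _ D q) => // n /=.
- by rewrite -creN -creD (le_trans (normRe_cmod _)).
- by rewrite -cimN -cimD (le_trans (normIm_cmod _)).
Qed.

End ComplexSequences.

Section WeightedNorm.
Context {R : realType} {n : nat}.
Local Notation C := R[i].
Variable W : R.
Hypothesis W1 : 1 <= W.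
Implicit Types (x y : 'cV[C]_n) (A : 'M[C]_n).

Let W0 : 0 <= W. Proof. exact: le_trans ler01 W1. Qed.
Let Wi0 i : 0 <= W ^+ i. Proof. exact: exprn_ge0. Qed.

(** A weighted l1-norm.  With a large [W], the entries of a matrix strictly above
    the diagonal count little in its operator norm, which [column_bound]
    estimates. *)
Definition wnorm x : R := \sum_(i < n) W ^+ i * cmod (x i 0).

Definition column_bound A c := forall j : 'I_n,
  \sum_(i < n) W ^+ i * cmod (A i j) <= c * W ^+ j.

Lemma wnorm_ge0 x : 0 <= wnorm x.
Proof. by apply: sumr_ge0 => i _; rewrite mulr_ge0// cmod_ge0. Qed.

Lemma wnormD x y : wnorm (x + y) <= wnorm x + wnorm y.
Proof.
rewrite -big_split /=; apply: ler_sum => i _.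
by rewrite mxE -mulrDr ler_wpM2l// cmodD.
Qed.

Lemma cmod_le_wnorm x l : cmod (x l 0) <= wnorm x.
Proof.
rewrite /wnorm (bigD1 l) //=; apply: ler_wpDr.
  by apply: sumr_ge0 => i _; rewrite mulr_ge0// cmod_ge0.
by rewrite ler_peMl ?cmod_ge0// exprn_ege1.
Qed.

Lemma wnorm_mulmx A c x : column_bound A c -> wnorm (A *m x) <= c * wnorm x.
Proof.
move=> Ac.
apply: (@le_trans _ _ (\sum_(i < n) \sum_(j < n) (W ^+ i * cmod (A i j)) * cmod (x j 0))).
  apply: ler_sum => i _; under eq_bigr do rewrite -mulrA; rewrite -mulr_sumr ler_wpM2l//.
  rewrite mxE; apply: le_trans (cmod_sum _ _ _) _.
  by apply: ler_sum => j _; rewrite cmodM.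
rewrite exchange_big /= /wnorm mulr_sumr; apply: ler_sum => j _.
by rewrite -mulr_suml mulrA ler_wpM2r ?cmod_ge0.
Qed.

(** Since [W ^+ j] is at least 1, an additive error goes into the factor. *)
Lemma column_bound_absorb A (c d e : R) : 0 <= e ->
  (forall j : 'I_n, \sum_(i < n) W ^+ i * cmod (A i j) <= c * W ^+ j + d) ->
  c + d <= e -> 0 <= d -> column_bound A e.
Proof.
move=> e0 h cde d0 j; apply: le_trans (h j) _.
apply: (@le_trans _ _ ((c + d) * W ^+ j)).
  by rewrite mulrDl lerD2l ler_peMr// exprn_ege1.
by rewrite ler_wpM2r.
Qed.

End WeightedNorm.

Section RefinementLimit.
Context {R : realType} {p : nat}.
Local Notation C := R[i].
Local Notation n := p.+1.
Variables (M : R -> 'M[C]_n) (v : 'cV[C]_n) (N : R).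
Hypothesis N0 : 0 <= N.
Hypothesis tM : forall i j, trig_poly N (fun s => M s i j).
Hypothesis M0_trig : forall i j : 'I_n, (j < i)%N -> M 0 i j = 0.
Hypothesis M0_diag : forall i, cmod (M 0 i i) <= 1.
Hypothesis M0v : M 0 *m v = v.

Definition partial_product k (s : R) : 'M[C]_n := \prod_(1 <= j < k.+1) M (2 ^- j * s).

Lemma partial_productSl k s :
  partial_product k.+1 s = M (s / 2) *m partial_product k (s / 2).
Proof.
rewrite /partial_product big_nat_recl// expr1 mulrC; congr (_ *m _).
apply: eq_bigr => j _; congr M.
by rewrite exprSr invfM -mulrA [2^-1 * s]mulrC.
Qed.

Lemma partial_productSr k s :
  partial_product k.+1 s = partial_product k s *m M (2 ^- k.+1 * s).
Proof. by rewrite /partial_product big_nat_recr. Qed.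

Lemma partial_product0 s : partial_product 0 s = 1%:M.
Proof. by rewrite /partial_product big_geq. Qed.

Definition partial_vector k s := partial_product k s *m v.

(** The frequencies do not pile up: if both factors of
    [M (s / 2) *m partial_vector k (s / 2)] have frequencies up to [N / 2], the
    product has frequencies up to [N]. *)
Lemma partial_vector_trig k l : trig_poly N (fun s => partial_vector k s l 0).
Proof.
elim: k l => [|k ih] l.
  by under eq_fun do rewrite /partial_vector partial_product0 mul1mx; exact: trig_poly_cst.
under eq_fun do rewrite /partial_vector partial_productSl -mulmxA mxE.
apply: trig_poly_sum => // j.
have -> : N = N / 2 + N / 2 by rewrite -splitr.
apply: (trig_polyM (F := fun s => M (s / 2) l j) (G := fun s => partial_vector k (s / 2) j 0)).
  exact: (trig_poly_half (tM l j)).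
exact: (trig_poly_half (ih j)).
Qed.

Let M_bounded : exists2 B, 0 <= B & forall s i j, cmod (M s i j) <= B.
Proof.
have h (ij : 'I_n * 'I_n) : exists B, 0 <= B /\ forall s, cmod (M s ij.1 ij.2) <= B.
  by have [B B0 hB] := trig_poly_bounded (tM ij.1 ij.2); exists B.
have [B hB] := choice h; exists (\sum_ij B ij).
  by apply: sumr_ge0 => ij _; have [] := hB ij.
move=> s i j; rewrite (bigD1 (i, j)) //=; apply: ler_wpDr.
  by apply: sumr_ge0 => ij _; have [] := hB ij.
by have [_] := hB (i, j).
Qed.

Let M_lipschitz : exists2 K, 0 <= K & forall s i j, cmod (M s i j - M 0 i j) <= K * `|s|.
Proof.
have h (ij : 'I_n * 'I_n) : exists B, 0 <= B /\
    forall s, cmod (M s ij.1 ij.2 - M 0 ij.1 ij.2) <= B * `|s|.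
  by have [B B0 hB] := trig_poly_lipschitz (tM ij.1 ij.2); exists B.
have [B hB] := choice h; exists (\sum_ij B ij).
  by apply: sumr_ge0 => ij _; have [] := hB ij.
move=> s i j; rewrite (bigD1 (i, j)) //= mulrDl; apply: ler_wpDr.
  by rewrite mulr_ge0//; apply: sumr_ge0 => ij _; have [] := hB ij.
by have [_] := hB (i, j).
Qed.

(** The diagonal of the triangular matrix [M 0] has modulus at most 1, so a
    rapidly growing weight brings its norm, and by continuity that of [M s] for
    small [s], down to 3/2.  What matters is that this is less than 2. *)
Let contraction : exists W e : R, [/\ 1 <= W, 0 < e &
  forall s, `|s| <= e -> column_bound W (M s) (3 / 2)].
Proof.
have [K K0 hK] := M_lipschitz.
pose S : R := \sum_i \sum_j cmod (M 0 i j).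
have S0 : 0 <= S by do 2!apply: sumr_ge0 => ? _; exact: cmod_ge0.
(* [W] is chosen so that S <= W / 4, and [e] so that the Lipschitz error of a
   whole column is at most 1/4. *)
pose W := 4 * S + 1; have W1 : 1 <= W by rewrite /W lerDr mulr_ge0.
have W0 : 0 < W by exact: lt_le_trans W1.
have Wi (i : nat) : 0 <= W ^+ i by rewrite exprn_ge0// ltW.
pose d := \sum_(i < n) W ^+ i * K.
have d0 : 0 <= d by apply: sumr_ge0 => i _; rewrite mulr_ge0.
pose e := (4 * (d + 1))^-1.
have e0 : 0 < e by rewrite invr_gt0 mulr_gt0// ltr_wpDl.
have de : d * e <= 4^-1.
  rewrite /e ler_pdivrMr ?mulr_gt0 ?ltr_wpDl//; lra.
exists W, e; split => // s se.
apply: (@column_bound_absorb _ _ W W1 _ (1 + 4^-1) (4^-1)); [by lra| |by lra|by lra].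
move=> j; apply: (@le_trans _ _ (\sum_(i < n) W ^+ i * cmod (M 0 i j) + \sum_(i < n) W ^+ i * K * e)).
  rewrite -big_split /=; apply: ler_sum => i _; rewrite -mulrA -mulrDr ler_wpM2l//.
  rewrite -{1}[M s i j](subrK (M 0 i j)) addrC.
  apply: le_trans (cmodD _ _) _; rewrite lerD2l//.
  by apply: le_trans (hK s i j) _; rewrite ler_wpM2l.
apply: lerD; last by rewrite -mulr_suml.
have colS (P : pred 'I_n) : \sum_(i | P i) cmod (M 0 i j) <= S.
  apply: (@le_trans _ _ (\sum_i cmod (M 0 i j))).
    by rewrite [leRHS](bigID P) /= lerDl sumr_ge0// => i _; exact: cmod_ge0.
  apply: ler_sum => i _; rewrite (bigD1 j) //= lerDl.
  by apply: sumr_ge0 => k _; exact: cmod_ge0.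
rewrite (bigD1 j) //= mulrDl mul1r; apply: lerD.
  by rewrite ler_piMr.
have off i : i != j -> W ^+ i * cmod (M 0 i j) <= W ^+ j / W * cmod (M 0 i j).
  move=> ij; have [ji|] := ltnP j i; first by rewrite M0_trig// cmod0 !mulr0.
  rewrite leq_eqVlt => /orP[/eqP/val_inj e1|ij']; first by rewrite e1 eqxx in ij.
  rewrite ler_wpM2r ?cmod_ge0// ler_pdivlMr// -exprSr.
  by rewrite ler_weXn2l.
apply: (le_trans (ler_sum _ (fun i ij => off i ij))).
rewrite -mulr_sumr -mulrA [X in X <= _]mulrC ler_wpM2r//.
rewrite mulrC ler_pdivrMr//; apply: (le_trans (colS _)); rewrite /W; lra.
Qed.

(** Near 0 the matrices have norm at most 3/2, so the products grow at most
    like [(3 / 2) ^+ k]; as [M 0] fixes [v], the next factor moves [v] by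
    [O(2 ^- k)], and the increments of [partial_vector] are [O((3 / 4) ^+ k)].
    Away from 0, [partial_vector k.+1 s = M (s / 2) *m partial_vector k (s / 2)]
    carries convergence from [s / 2] to [s] and multiplies the bound by at most
    [2 ^+ L], which a growth of order [L] absorbs. *)
Lemma partial_vector_limits : exists K L, [/\ 0 <= K,
  forall k l, poly_growth K L (fun s => partial_vector k s l 0) &
  forall s l, ccvgn (fun k => partial_vector k s l 0)].
Proof.
have [W [e [W1 e0 hc]]] := contraction.
have W0 : 0 < W by exact: lt_le_trans W1.
have Wi (i : nat) : 0 <= W ^+ i by rewrite exprn_ge0// ltW.
have [B B0 hB] := M_bounded; have [Kl Kl0 hKl] := M_lipschitz.
have halve (s : R) : `|s / 2| = `|s| / 2 by rewrite normrM [`|2^-1|]ger0_norm.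
have near0 k x s : `|s| <= e -> wnorm W (partial_product k s *m x) <= (3 / 2) ^+ k * wnorm W x.
  elim: k x s => [|k ih] x s se; first by rewrite partial_product0 mul1mx expr0 mul1r.
  have se2 : `|s / 2| <= e by rewrite halve; have := normr_ge0 s; lra.
  rewrite partial_productSl -mulmxA; apply: le_trans (wnorm_mulmx W1 _ (hc _ se2)) _.
  by rewrite exprS -mulrA ler_wpM2l ?ih//; lra.
pose D0 := \sum_(i < n) W ^+ i * \sum_j Kl * cmod (v j 0).
have D00 : 0 <= D0.
  apply: sumr_ge0 => i _; rewrite mulr_ge0//.
  by apply: sumr_ge0 => j _; rewrite mulr_ge0 ?cmod_ge0.
have incr0 s : wnorm W ((M s - M 0) *m v) <= D0 * `|s|.
  rewrite /wnorm /D0 mulr_suml; apply: ler_sum => i _.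
  rewrite -mulrA ler_wpM2l// mxE mulr_suml.
  apply: le_trans (cmod_sum _ _ _) _; apply: ler_sum => j _.
  by rewrite cmodM !mxE mulrAC ler_wpM2r ?cmod_ge0.
pose D := D0 * e; have D_ge0 : 0 <= D by rewrite mulr_ge0// ltW.
have incr k s : `|s| <= e ->
    wnorm W (partial_vector k.+1 s - partial_vector k s) <= D * (3 / 4) ^+ k.
  move=> se; rewrite /partial_vector partial_productSr -mulmxA -mulmxBr.
  rewrite -{2}M0v -mulmxBl; apply: le_trans (near0 k _ s se) _.
  apply: le_trans (ler_wpM2l _ (incr0 _)) _; first by rewrite exprn_ge0//; lra.
  have -> : (3 / 4 : R) ^+ k = (3 / 2) ^+ k * 2^-1 ^+ k.
    by rewrite -exprMn; congr (_ ^+ _); lra.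
  rewrite normrM ger0_norm ?invr_ge0 ?exprn_ge0// -exprVn exprS.
  have a0 : 0 <= (3 / 2 : R) ^+ k by rewrite exprn_ge0//; lra.
  have q0 : 0 <= (2^-1 : R) ^+ k by rewrite exprn_ge0.
  rewrite /D; move: (_ ^+ k) (_ ^+ k) a0 q0 => q a a0 q0.
  rewrite (_ : a * _ = D0 * a * q * (`|s| / 2)); last by ring.
  rewrite (_ : D0 * e * _ = D0 * a * q * e); last by ring.
  by rewrite ler_wpM2l ?mulr_ge0//; have := normr_ge0 s; lra.
have cvg0 s l : `|s| <= e -> ccvgn (fun k => partial_vector k s l 0).
  move=> se; apply: (@ccvgn_geometric_increments _ _ D (3 / 4)) => // [|k]; first lra.
  apply: le_trans (incr k s se); have := cmod_le_wnorm W1 (partial_vector k.+1 s - partial_vector k s) l.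
  by rewrite !mxE.
(* 4 is the sum of the geometric series of ratio 3/4 *)
pose K0 := wnorm W v + 4 * D.
have D4 : 0 <= 4 * D by exact: mulr_ge0.
have K00 : 0 <= K0 by apply: addr_ge0; [exact: wnorm_ge0|exact: mulr_ge0].
have bound0 k s : `|s| <= e -> wnorm W (partial_vector k s) <= K0.
  move=> se; suff : wnorm W (partial_vector k s) <= wnorm W v + 4 * D * (1 - (3 / 4) ^+ k).
    move=> h; apply: (le_trans h); rewrite lerD2l ler_piMr//.
  elim: k => [|k ih]; first by rewrite /partial_vector partial_product0 mul1mx expr0 subrr mulr0 addr0.
  rewrite -[partial_vector k.+1 s](subrK (partial_vector k s)).
  apply: le_trans (wnormD W1 _ _) _; have := incr k s se; rewrite exprS; move: ih.
  move: (wnorm _ _) (wnorm _ (_ - _)) (wnorm _ v) ((3 / 4) ^+ k) => a a' a'' q; nra.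
have [L hL] : exists L : nat, forall s, column_bound W (M s) (2 ^+ L).
  pose c := \sum_(i < n) W ^+ i * B.
  have c0 : 0 <= c by apply: sumr_ge0 => i _; rewrite mulr_ge0.
  exists (Num.bound c) => s.
  apply: (@column_bound_absorb _ _ W W1 _ 0 c) => //.
  - move=> j; rewrite mul0r add0r; apply: ler_sum => i _.
    by rewrite ler_wpM2l.
  - rewrite add0r (le_trans (ltW (archi_boundP c0)))// -natrX ler_nat ltnW//.
    exact: ltn_expl.
(* doubling [s] beyond [e] multiplies [m s ^+ L] by [2 ^+ L], the bound for one
   factor *)
pose m (s : R) : R := Num.max 1 (2 * `|s| / e).
have growth k s : wnorm W (partial_vector k s) <= K0 * m s ^+ L.
  have m1 t : 1 <= m t by rewrite /m le_max lexx.
  have base j t : `|t| <= e -> wnorm W (partial_vector j t) <= K0 * m t ^+ L.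
    by move=> te; apply: (le_trans (bound0 j t te)); rewrite ler_peMr// exprn_ege1.
  elim: k s => [|k ih] s; have [/base//|es] := leP `|s| e.
    rewrite /partial_vector partial_product0 mul1mx.
    apply: (@le_trans _ _ K0); first by rewrite lerDl.
    by rewrite ler_peMr// exprn_ege1.
  rewrite /partial_vector partial_productSl -mulmxA.
  apply: le_trans (wnorm_mulmx W1 _ (hL _)) _.
  apply: le_trans (ler_wpM2l _ (ih (s / 2))) _; first by rewrite exprn_ge0.
  rewrite mulrCA ler_wpM2l// -exprMn lerXn2r ?nnegrE ?mulr_ge0//.
  - by rewrite (le_trans ler01).
  - by rewrite (le_trans ler01).
  have r1 : 1 < `|s| / e by rewrite ltr_pdivlMr// mul1r.
  rewrite /m halve mulrCA mulrA mulfK// -mulrA /Num.max !ifT//; lra.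
exists (K0 * (1 + (2 / e) ^+ L)), L; split.
- by rewrite mulr_ge0// addr_ge0// exprn_ge0// divr_ge0// ltW.
- move=> k l s; apply: le_trans (cmod_le_wnorm W1 _ _) _.
  apply: le_trans (growth k s) _; rewrite -mulrA ler_wpM2l//.
  apply: (@le_trans _ _ (1 + (2 / e) ^+ L * `|s| ^+ L)); last first.
    have a0 : 0 <= (2 / e) ^+ L by rewrite exprn_ge0// divr_ge0// ltW.
    have b0 : 0 <= `|s| ^+ L by rewrite exprn_ge0.
    move: (_ ^+ L) (_ ^+ L) a0 b0 => y x x0 y0.
    by rewrite (_ : (1 + x) * _ = 1 + x * y + (x + y)) ?lerDl ?addr_ge0//; ring.
  rewrite -exprMn mulrAC /m /Num.max; case: ifP => _.
    by rewrite lerDr.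
  by rewrite expr1n lerDl exprn_ge0// divr_ge0 ?mulr_ge0// ltW.
- have main J : forall s l, `|s| <= 2 ^+ J * e -> ccvgn (fun k => partial_vector k s l 0).
    elim: J => [|J ih] s l; first by rewrite expr0 mul1r; exact: cvg0.
    rewrite exprS -mulrA => sJ; apply: ccvgn_shiftS.
    under eq_fun do rewrite /partial_vector partial_productSl -mulmxA mxE.
    apply: ccvgn_sum => j; apply: ccvgnZ; apply: ih.
    by rewrite halve; lra.
  move=> s l; have se : 0 <= `|s| / e by rewrite divr_ge0// ltW.
  apply: (main (Num.bound (`|s| / e))); rewrite -ler_pdivrMr//.
  apply: (le_trans (ltW (archi_boundP se))); rewrite -natrX ler_nat ltnW//.
  exact: ltn_expl.
Qed.

End RefinementLimit.

(** * The symbol of the dual quark mask at 1 *)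

Section MatrixSymbols.
Context {R : realType}.
Local Notation C := R[i].

Lemma fsbig_seq_support (V : nmodType) (G : int -> V) (s : seq int) : uniq s ->
  (forall k, k \notin s -> G k = 0) ->
  \sum_(k \in [set: int]) G k = \sum_(k <- s) G k.
Proof.
move=> us G0; rewrite -(@fsbig_widen _ _ 0 _ [set` s] [set: int]) -?fsbig_seq//.
by move=> k [_ /= ks]; apply: G0; apply/negP.
Qed.

Lemma matrix_symbolE (n : nat) (A : int -> 'M[C]_n) (s : seq int) z : uniq s ->
  (forall k, A k != 0 -> k \in s) ->
  matrix_symbol A z = 2^-1 *: \sum_(k <- s) (z ^ k *: A k).
Proof.
move=> us As; rewrite /matrix_symbol.
rewrite (fsbig_seq_support us) // => k ks; apply/eqP; rewrite scaler_eq0.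
by apply/orP; right; apply: contraNT ks => /As.
Qed.

Lemma finitely_supportedP (V : nmodType) (c : int -> V) : finitely_supported c ->
  exists2 s : seq int, uniq s & forall k, c k != 0 -> k \in s.
Proof.
move=> fc; exists (finmap.enum_fset (fset_set [set k | c k != 0])); first exact: finmap.fset_uniq.
by move=> k ck; rewrite in_fset_set// inE.
Qed.

Lemma matrix_symbol_trig_poly (n : nat) (A : int -> 'M[C]_n) (a : C) :
  finitely_supported A -> exists2 N : R, 0 <= N & forall i j,
    trig_poly N (fun s => (a *: matrix_symbol A (cexpi (- s))) i j).
Proof.
move=> /finitely_supportedP[s us As].
pose N : R := \sum_(k <- s) `|k%:~R|.
have N0 : 0 <= N by exact: sumr_ge0.
exists N => // i j.
have -> : (fun x : R => (a *: matrix_symbol A (cexpi (- x))) i j) =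
  fun x => \sum_(k <- s) (if k \in s then (a * 2^-1 * A k i j) * cexpi (- k%:~R * x) else 0).
  apply/funext => x; rewrite (matrix_symbolE _ us As) !mxE mulrA summxE mulr_sumr.
  rewrite big_seq [RHS]big_seq; apply: eq_bigr => k ks.
  by rewrite ks mxE cexpiMz mulrN mulNr; ring.
apply: trig_poly_sum => // k; have [ks|_] := boolP (k \in s); last exact: trig_poly_cst.
apply: trig_poly_exp; rewrite normrN /N (big_rem k) //= lerDl; exact: sumr_ge0.
Qed.

End MatrixSymbols.

Section SymbolsAtOne.
Context {R : realType}.
Local Notation C := R[i].

Lemma quark_mask_support (m p : nat) (k : int) : @quark_mask R m p k != 0 ->
  k \in [seq (i%:Z - (m./2)%:Z) | i <- iota 0 m.+1].
Proof.
move=> Ak.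
have /andP[k1 k2] : (- (m./2)%:Z <= k <= (uphalf m)%:Z).
  apply: contraNT Ak => /negbTE nk; apply/eqP/matrixP => i j.
  by rewrite !mxE /spline_mask nk mulr0 !mul0r.
have km : (0 <= k + (m./2)%:Z <= m%:Z).
  rewrite -lerBlDr sub0r k1 /= -lerBrDr (le_trans k2)//.
  by have := odd_double_half m; rewrite uphalf_half -addnn; lia.
apply/mapP; exists (absz (k + (m./2)%:Z)).
  by rewrite mem_iota; lia.
by lia.
Qed.

(** The binomial theorem for [(1 + 1) ^ m]. *)
Lemma spline_mask_sum (m : nat) : (0 < m)%N ->
  \sum_(k <- [seq (i%:Z - (m./2)%:Z) | i <- iota 0 m.+1]) @spline_mask R m k = 2.
Proof.
move=> m0; rewrite big_map.
have e (i : nat) : (i < m.+1)%N ->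
    @spline_mask R m (i%:Z - (m./2)%:Z) = 2 ^ (1 - m%:Z) * 'C(m, i)%:R.
  move=> im; rewrite /spline_mask subrK absz_nat ifT//.
  by have := odd_double_half m; rewrite uphalf_half -addnn; lia.
rewrite -[iota 0 m.+1]/(index_iota 0 m.+1) big_nat.
under eq_bigr => i im do rewrite e//.
rewrite -big_nat -mulr_sumr big_mkord -natr_sum.
have -> : (\sum_(i < m.+1) 'C(m, i) = 2 ^ m)%N.
  have := expnDn 1 1 m; rewrite addn1 => ->.
  by apply: eq_bigr => i _; rewrite !exp1n !muln1.
by rewrite natrX exprnP -expfzDr ?pnatr_eq0// subrK expr1z.
Qed.

(** The binomial coefficients vanish above the diagonal, and on the
    diagonal only the sum of the spline mask remains. *)
Lemma quark_symbol1 (m p : nat) : (0 < m)%N ->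
  (forall i j : 'I_p.+1, (i < j)%N -> matrix_symbol (@quark_mask R m p) 1 i j = 0) /\
  (forall i : 'I_p.+1, matrix_symbol (@quark_mask R m p) 1 i i = 2 ^- i).
Proof.
move=> m0; set s := [seq (i%:Z - (m./2)%:Z) | i <- iota 0 m.+1].
have us : uniq s by rewrite map_inj_uniq ?iota_uniq// => x y /addIr[].
have E := matrix_symbolE 1 us (@quark_mask_support m p).
split=> [i j ij|i]; rewrite E mxE summxE.
  by rewrite big1 ?mulr0// => k _; rewrite !mxE bin_small// mulr0 mul0r mulr0.
under eq_bigr => k _ do rewrite !mxE subrr !expr0z !mulr1 binn mulr1 exp1rz mul1r.
by rewrite -mulr_sumr spline_mask_sum// mulrCA mulVf ?mulr1.
Qed.

(** The factor [((1 + z) / 2) ^+ mt] of the dual symbol vanishes at -1. *)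
Lemma wavelet_symbol1 (m mt : nat) (b : int -> R) : (0 < mt)%N ->
  is_wavelet_mask m mt b -> scalar_symbol b 1 = 0.
Proof.
move=> mt0 [_ hb]; rewrite hb ?normr1// /cdf_dual_symbol subrr mul0r expr0n.
by rewrite (gtn_eqF mt0) mulr0 mul0r rmorph0 mulr0.
Qed.

(** At 1 only the term of index 0 of the sum survives. *)
Lemma wavelet_symbolN1 (m mt : nat) (b : int -> R) : (0 < m)%N -> (0 < mt)%N ->
  is_wavelet_mask m mt b -> scalar_symbol b (- 1) = 1.
Proof.
move=> m0 mt0 [_ hb]; rewrite hb ?normrN ?normr1// opprK mul1r.
have K0 : (0 < (m + mt)./2)%N by rewrite half_gt0; lia.
rewrite /cdf_dual_symbol expr1n invr1 divff ?expr1n ?mul1r//.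
case: ((m + mt)./2) K0 => // K _; rewrite big_ord_recl big1 /=.
  by rewrite expr0 mulr1 addn0 bin0 addr0 rmorph1.
move=> i _; rewrite (_ : 2 - 1 - 1 = 0 :> C); last by ring.
by rewrite mul0r /bump leq0n add1n exprS mul0r mulr0.
Qed.

Lemma lower_triangular_inverse (F : fieldType) n (T X : 'M[F]_n) :
  (forall i j : 'I_n, (i < j)%N -> T i j = 0) -> (forall i, T i i != 0) -> T *m X = 1%:M ->
  (forall i j : 'I_n, (i < j)%N -> X i j = 0) /\ (forall i, X i i = (T i i)^-1).
Proof.
move=> Tt Td TX.
have E i j : \sum_k T i k * X k j = (i == j)%:R.
  by move/matrixP: TX => /(_ i j); rewrite !mxE.
(* induction on the row: row i of T X = 1 involves only the rows of X up to i *)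
have Xt : forall r (i j : 'I_n), (i < r)%N -> (i < j)%N -> X i j = 0.
  elim=> // r ih i j ir ij.
  have := E i j; rewrite (bigD1 i) //= big1; last first.
    move=> k ki; have [kl|] := ltnP k i; first by rewrite ih ?mulr0//; lia.
    by rewrite leq_eqVlt => /orP[/eqP/val_inj e|/Tt->]; [rewrite e eqxx in ki|rewrite mul0r].
  rewrite addr0 (_ : (i == j) = false); last by apply/eqP => e; rewrite e ltnn in ij.
  by move/eqP; rewrite mulf_eq0 (negbTE (Td i)) /= => /eqP.
split=> [i j|i]; first exact: (Xt i.+1).
have := E i i; rewrite (bigD1 i) //= big1; last first.
  move=> k ki; have [kl|] := ltnP k i; first by rewrite (Xt i) ?mulr0.
  by rewrite leq_eqVlt => /orP[/eqP/val_inj e|/Tt->]; [rewrite e eqxx in ki|rewrite mul0r].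
by rewrite addr0 eqxx => e; rewrite -[LHS](mulKf (Td i)) e mulr1.
Qed.

(** As [b] vanishes at 1 and equals 1 at -1, the transition matrix at 1 is the
    symbol of the quark mask, which is lower triangular; the dual symbol is the
    conjugate transpose of its inverse. *)
Lemma dual_quark_symbol1 (m mt p : nat) (b : int -> R) (At : int -> 'M[C]_p.+1) :
  (0 < m)%N -> (0 < mt)%N -> is_wavelet_mask m mt b -> is_dual_quark_mask m b At ->
  (forall i j : 'I_p.+1, (j < i)%N -> matrix_symbol At 1 i j = 0) /\
  (forall i : 'I_p.+1, matrix_symbol At 1 i i = 2 ^+ i).
Proof.
move=> m0 mt0 hb [_ hAt].
have b1 := wavelet_symbol1 mt0 hb; have bN1 := wavelet_symbolN1 m0 mt0 hb.
have [Qt Qd] := @quark_symbol1 m p m0.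
have TE : transition_matrix m p b 1 = matrix_symbol (@quark_mask R m p) 1.
  by rewrite /transition_matrix b1 bN1 scale1r scale0r subr0.
have Td i : transition_matrix m p b 1 i i != 0.
  by rewrite TE Qd invr_eq0 expf_neq0// pnatr_eq0.
have Tu : transition_matrix m p b 1 \in unitmx.
  rewrite unitmxE det_trig; last by apply/is_trig_mxP => i j ij; rewrite TE Qt.
  by rewrite unitfE; apply/prodf_neq0 => i _.
have Tt (i j : 'I_p.+1) : (i < j)%N -> transition_matrix m p b 1 i j = 0 by rewrite TE; exact: Qt.
have [Xt Xd] := lower_triangular_inverse Tt Td (mulmxV Tu).
have := hAt 1 (normr1 _); rewrite bN1 scale1r => hX.
have XE i j : matrix_symbol At 1 i j = Num.conj (invmx (transition_matrix m p b 1) j i).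
  by rewrite -hX !mxE conjCK.
split=> [i j ji|i]; rewrite XE; first by rewrite Xt// rmorph0.
by rewrite Xd TE Qd invrK rmorphXn /= rmorph_nat.
Qed.

Definition refinement_factor (p : nat) (At : int -> 'M[C]_p.+1) (s : R) : 'M[C]_p.+1 :=
  2 ^- p *: matrix_symbol At (cexpi (- s)).

Lemma refinement_factor0 (p : nat) (At : int -> 'M[C]_p.+1) :
  refinement_factor At 0 = 2 ^- p *: matrix_symbol At 1.
Proof. by rewrite /refinement_factor oppr0 cexpi0. Qed.

(** The normalisation [2 ^- p] makes all diagonal entries [2 ^+ i] at most 1. *)
Lemma refinement_factor0_triangular (m mt p : nat) (b : int -> R)
    (At : int -> 'M[C]_p.+1) :
  (0 < m)%N -> (0 < mt)%N -> is_wavelet_mask m mt b -> is_dual_quark_mask m b At ->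
  (forall i j : 'I_p.+1, (j < i)%N -> refinement_factor At 0 i j = 0) /\
  (forall i : 'I_p.+1, cmod (refinement_factor At 0 i i) <= 1).
Proof.
move=> m0 mt0 hb hAt; have [] := dual_quark_symbol1 m0 mt0 hb hAt.
rewrite refinement_factor0; move: (matrix_symbol At 1) => X Xt Xd.
split=> [i j ji|i]; rewrite mxE; first by rewrite Xt// mulr0.
rewrite Xd cmodM cmodV !cmodX cmod_nat mulrC ler_pdivrMr ?exprn_gt0// mul1r.
by rewrite ler_weXn2l ?ler1n// -ltnS.
Qed.

End SymbolsAtOne.

(** * Dual quarks and dual quarklets *)

Section DualQuarks.
Context {R : realType} {p : nat}.
Local Notation C := R[i].

Lemma dual_quark_tempered_compact (m mt : nat) (b : int -> R)
    (At : int -> 'M[C]_p.+1) (v : 'cV[C]_p.+1) :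
  (0 < m)%N -> (0 < mt)%N -> is_wavelet_mask m mt b -> is_dual_quark_mask m b At ->
  (2 ^- p *: matrix_symbol At 1) *m v = v ->
  exists2 N, 0 <= N & forall l,
    tempered (dual_quark At v l) /\ vanishes_outside N (dual_quark At v l).
Proof.
move=> hm hmt hb hAt hv.
have [N N0 tM] := matrix_symbol_trig_poly (2 ^- p) hAt.1.
have [M0_trig M0_diag] := refinement_factor0_triangular hm hmt hb hAt.
have M0v : refinement_factor At 0 *m v = v by rewrite refinement_factor0.
have [K [L [K0 grow cv]]] :=
  partial_vector_limits (M := refinement_factor At) tM M0_trig M0_diag M0v.
pose F (l : 'I_p.+1) (s : R) := refinement_product At v s l 0.
pose F_ (l : 'I_p.+1) k (s : R) := partial_vector (refinement_factor At) v k s l 0.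
have FE l s : F l s = clim (fun k => F_ l k s) by rewrite /F /refinement_product mxE.
have FRe l s : complex.Re (F_ l k s) @[k --> \oo] --> complex.Re (F l s).
  by rewrite FE; have [] := cv s l.
have FIm l s : complex.Im (F_ l k s) @[k --> \oo] --> complex.Im (F l s).
  by rewrite FE; have [] := cv s l.
have tF l k : trig_poly N (F_ l k) by exact: partial_vector_trig.
have mF l : cmeasurable (F l).
  split.
  - apply: (@measurable_fun_cvg _ _ _ _ (fun k => @complex.Re R \o F_ l k)) => [k|s _].
      by have [] := ccontinuous_measurable (trig_poly_continuous (tF l k)).
    exact: FRe.
  - apply: (@measurable_fun_cvg _ _ _ _ (fun k => @complex.Im R \o F_ l k)) => [k|s _].
      by have [] := ccontinuous_measurable (trig_poly_continuous (tF l k)).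
    exact: FIm.
have growF l : poly_growth (2 * K) L (F l).
  move=> s; apply: le_trans (cmod_ReIm _) _; rewrite -mulrA mulr_natl mulr2n.
  apply: lerD.
  - apply: (cvgr_to_le (cvg_norm (FRe l s))); apply: nearW => k.
    exact: le_trans (normRe_cmod _) (grow k l s).
  - apply: (cvgr_to_le (cvg_norm (FIm l s))); apply: nearW => k.
    exact: le_trans (normIm_cmod _) (grow k l s).
have K20 : 0 <= 2 * K by rewrite mulr_ge0.
have iterP (P : @functional R -> Prop) : (forall w, P w -> P (dist_derive w)) ->
    forall w r, P w -> P (iter r dist_derive w).
  by move=> hP w r Pw; elim: r => //= r; exact: hP.
have tu l : tempered (dual_quark At v l).
  apply: iterP; first exact: tempered_dist_derive.
  exact: (tempered_ifourier K20 (mF l) (growF l)).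
have vu l : vanishes_outside N (dual_quark At v l).
  apply: (iterP (vanishes_outside N)); first exact: vanishes_outside_dist_derive.
  exact: (vanishes_outside_ifourier K0 (tF l) (fun k => grow k l) (FRe l) (FIm l)).
by exists N.
Qed.

Lemma dual_quarklet_finite_sum (At Bt : int -> 'M[C]_p.+1) (v : 'cV[C]_p.+1) q :
  finitely_supported Bt -> exists s : seq int, dual_quarklet At Bt v q =
    fun f => \sum_(kl <- [seq (k, l) | k <- s, l <- enum 'I_p.+1])
      Bt kl.1 q kl.2 * dist_dilate kl.1 (dual_quark At v kl.2) f.
Proof.
move=> /finitely_supportedP[s us Bs]; exists s; apply/funext => f.
rewrite big_allpairs /dual_quarklet.
pose G k := \sum_(l < p.+1) Bt k q l * dist_dilate k (dual_quark At v l) f.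
have G0 k : k \notin s -> G k = 0.
  move=> ks; have Bk : Bt k = 0 by apply/eqP; apply: contraNT ks => /Bs.
  by rewrite /G big1// => l _; rewrite Bk mxE mul0r.
rewrite (fsbig_seq_support us G0).
by apply: eq_bigr => k _; rewrite /G big_enum.
Qed.

End DualQuarks.

Theorem lemma5p8 (R : realType) (m mt p : nat)
    (hm : (0 < m)%N) (hmt : (0 < mt)%N) (hle : (m <= mt)%N)
    (heven : ~~ odd (m + mt))
    (b : int -> R) (hb : is_wavelet_mask m mt b)
    (At Bt : int -> 'M[R[i]]_p.+1)
    (hAt : is_dual_quark_mask m b At)
    (hBt : is_dual_quarklet_mask m b Bt)
    (v : 'cV[R[i]]_p.+1) (hv0 : v <> 0)
    (hv : (2 ^- p *: matrix_symbol At 1) *m v = v) :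
  forall q : 'I_p.+1,
    tempered (dual_quarklet At Bt v q) /\
    compactly_supported (dual_quarklet At Bt v q).
Proof.
move=> q; have [N N0 /all_and2[tu vu]] := dual_quark_tempered_compact hm hmt hb hAt hv.
have [s E] := dual_quarklet_finite_sum At v q hBt.1.
rewrite E; split.
  apply: (@tempered_lin_comb _ _ _ (fun kl => Bt kl.1 q kl.2)
    (fun kl => dist_dilate kl.1 (dual_quark At v kl.2))) => -[k l].
  exact: tempered_dist_dilate.
apply: (@vanishes_outside_compactly_supported _ (N + \sum_(k <- s) `|k%:~R|)).
move=> f [sf [e [B [e0 fB]]]]; rewrite big_seq big1// => -[k l].
case/allpairsP => -[k' l'] /= [ks _ [-> _]].
suff -> : dist_dilate k' (dual_quark At v l) f = 0 by rewrite mulr0.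
apply: (vanishes_outside_dist_dilate N0 (vu l)); split=> //.
exists e, B; split=> // x /fB /andP[h1 h2]; rewrite h2 andbT; apply: le_trans h1.
rewrite lerD2r lerD2l (big_rem k') //= lerDl; exact: sumr_ge0.
Qed.
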